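(* Let $N\sim N(0,1)$ and let $\mathrm{PSO}(N)\subseteq A_1(\mathbb{R})$ be the class of all polynomial Stein operators for $N$. Then: (a) $\mathrm{PSO}(N)$ is a vector space over $\mathbb{R}$ with basis $$\mathfrak{B}=\{S(k,t):=H_k\partial^t-H_{k+t}\;:\;k\in\mathbb{N}_0,\ t\in\mathbb{N},\ t\ge 1\}.$$ (b) $\mathrm{PSO}(N)$ is a principal maximal right ideal of $A_1(\mathbb{R})$, and $$\mathrm{PSO}(N)=\langle G\rangle_{A_1(\mathbb{R})}=G\,A_1(\mathbb{R}):=\{GL\;:\;L\in A_1(\mathbb{R})\},$$ where $G=\partial-x$. (Equivalently, $\mathrm{PSO}(N)$, as a module over $A_1(\mathbb{R})$, is cyclic.) (c) $\mathrm{PSO}(N)$, as an $A_1(\mathbb{R})$-module, is not holonomic, although the quotient $A_1(\mathbb{R})/\mathrm{PSO}(N)$ is a holonomic module. In addition, $d(A_1(\mathbb{R})/\mathrm{PSO}(N))=1$ and $d(\mathrm{PSO}(N))=2$.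
   Context: $A_1(\mathbb{R})$ is the first Weyl algebra: the ring of linear differential operators $\sum_{t=0}^T p_t\partial^t$ with polynomial coefficients $p_t\in\mathbb{R}[x]$, where $\partial=\frac{d}{dx}$ and multiplication is composition of operators. Polynomial Stein operators. All random variables are real-valued. For a continuous random variable $X$ and a class $\mathcal{F}$ of functions, an operator $S=\sum_{t=0}^{T}p_t\partial^t$ ($T\ge1$, $p_t\in\mathbb{R}[x]$) is a polynomial Stein operator for $X$ if $Sf\in L^1(X)$ (i.e. $\mathbb{E}|Sf(X)|<\infty$) and $\mathbb{E}[Sf(X)]=0$ for all $f\in\mathcal{F}$; $\mathrm{PSO}_{\mathcal{F}}(X)$ is the set of all of them (it contains $0$), and $\mathrm{PSO}(X)$ is shorthand for $\mathrm{PSO}_{\mathcal{F}}(X)$. Convention: $\mathcal{F}$ is the Schwartz class $\mathcal{S}(\mathbb{R})$; when, as for $N$, all moments of the target random variable exist, the results are also asserted for $\mathcal{F}=\mathbb{R}[x]$, for $\mathcal{F}=P(\mathbb{R})=\{f\in C^\infty(\mathbb{R}):\sup_{x}|(1+x^\alpha)^{-1}\partial^\beta f(x)|<\infty$ for all $\beta\in\mathbb{N}_0$ and some $\alpha\ge1\}$ (smooth functions of polynomial growth), and for the operator-dependent class of all $f\in C^T(I)$ ($I$ the support of $X$) with $\mathbb{E}|X^jf^{(t)}(X)|<\infty$ for $0\le j\le \max_t\deg p_t$, $0\le t\le T$. Hermite polynomials: $H_0=1$ and $H_n(x)=xH_{n-1}(x)-H_{n-1}'(x)$ for $n\ge1$.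 In $S(k,t)$, $H_k\partial^t$ is the operator $f\mapsto H_kf^{(t)}$ and $H_{k+t}$ is the multiplication operator. Bernstein dimension and holonomic modules. The Bernstein filtration of $A_1(\mathbb{R})$ is $\mathscr{F}_\nu=\mathrm{span}_{\mathbb{R}}\{x^\alpha\partial^\beta:\alpha+\beta\le\nu\}$, $\nu\ge0$. A filtration of an $A_1(\mathbb{R})$-module $M$ is an increasing sequence of finite-dimensional real subspaces $\Gamma_\nu$ with union $M$, compatible with the Bernstein filtration ($\mathscr{F}_k\Gamma_\nu\subset\Gamma_{\nu+k}$ for left modules, $\Gamma_\nu\mathscr{F}_k\subset\Gamma_{\nu+k}$ for right modules); it is good if the associated graded module $\Gamma_0\oplus\Gamma_1/\Gamma_0\oplus\Gamma_2/\Gamma_1\oplus\cdots$ is finitely generated over the associated graded ring $\mathscr{F}_0\oplus\mathscr{F}_1/\mathscr{F}_0\oplus\cdots$. For a finitely generated $M$ with a good filtration, $\dim_{\mathbb{R}}\Gamma_\nu$ is, for $\nu$ large, a polynomial in $\nu$ whose degree $d(M)$ is independent of the good filtration; $d(M)$ is the Bernstein dimension of $M$. A finitely generated $A_1(\mathbb{R})$-module $M$ is holonomic if $d(M)=1$. Here $\mathrm{PSO}(N)$ and $A_1(\mathbb{R})/\mathrm{PSO}(N)$ are regarded as right $A_1(\mathbb{R})$-modules. *)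

(* Defs.v *)
From HB Require Import structures.
From mathcomp Require Import all_boot all_order all_algebra.
From mathcomp Require Import all_classical all_reals all_analysis.

Set Implicit Arguments.
Unset Strict Implicit.
Unset Printing Implicit Defensive.

Import Order.TTheory GRing.Theory Num.Theory.
Import numFieldNormedType.Exports.

Local Open Scope classical_set_scope.
Local Open Scope ring_scope.

(** [Weyl p] is the operator [\sum_t p`_t d^t]: the outer variable of
    [p : {poly {poly R}}] is the derivation [d], the inner one is [x].  It is a
    separate record because the product is not that of [{poly {poly R}}]. *)
Record weyl (R : comNzRingType) := Weyl { weyl_coef : {poly {poly R}} }.

Section WeylAlgebra.
Variable R : comNzRingType.
Local Notation W := {poly {poly R}}.
Implicit Types (a : {poly R}) (p q r : W).

HB.instance Definition _ := [isNew for (@weyl_coef R)].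
HB.instance Definition _ := [Choice of weyl R by <:].

Lemma weyl_coef_inj : injective (@weyl_coef R).
Proof. exact: val_inj. Qed.

Definition weyl_add (u v : weyl R) := Weyl (weyl_coef u + weyl_coef v).
Definition weyl_opp (u : weyl R) := Weyl (- weyl_coef u).

Fact weyl_addA : associative weyl_add.
Proof. by move=> u v w; apply: weyl_coef_inj; rewrite /= addrA. Qed.
Fact weyl_addC : commutative weyl_add.
Proof. by move=> u v; apply: weyl_coef_inj; rewrite /= addrC. Qed.
Fact weyl_add0 : left_id (Weyl 0) weyl_add.
Proof. by move=> u; apply: weyl_coef_inj; rewrite /= add0r. Qed.
Fact weyl_addN : left_inverse (Weyl 0) weyl_opp weyl_add.
Proof. by move=> u; apply: weyl_coef_inj; rewrite /= addNr. Qed.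

HB.instance Definition _ :=
  GRing.isZmodule.Build (weyl R) weyl_addA weyl_addC weyl_add0 weyl_addN.

(** Left multiplication by [d]: [d (\sum_t q_t d^t) = \sum_t (q_t' d^t + q_t d^(t+1))]. *)
Definition dmul q : W := map_poly (@deriv R) q + q * 'X.

Definition wmul p q : W := \sum_(i < size p) p`_i *: iter i dmul q.

Lemma wmulE n p q : (size p <= n)%N ->
  wmul p q = \sum_(i < n) p`_i *: iter i dmul q.
Proof.
move=> le_pn; rewrite /wmul (big_ord_widen _ (fun i => p`_i *: iter i dmul q) le_pn).
rewrite big_mkcond /=; apply: eq_bigr => i _; case: ltnP => // le_pi.
by rewrite nth_default // scale0r.
Qed.

Lemma dmulD q r : dmul (q + r) = dmul q + dmul r.
Proof. by rewrite /dmul raddfD /= mulrDl addrACA. Qed.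

Lemma dmul0 : dmul 0 = 0.
Proof. by rewrite /dmul raddf0 mul0r addr0. Qed.

Lemma dmulZ a q : dmul (a *: q) = a^`() *: q + a *: dmul q.
Proof.
rewrite /dmul scalerDr addrA -scalerAl; congr (_ + _).
by apply/polyP=> i; rewrite !(coefD, coefZ) !coef_map_id0 ?deriv0 // coefZ derivM.
Qed.

Lemma dmul_sum I (s : seq I) (F : I -> W) :
  dmul (\sum_(i <- s) F i) = \sum_(i <- s) dmul (F i).
Proof. exact: (big_morph dmul dmulD dmul0). Qed.

Lemma iter_dmulD n q r : iter n dmul (q + r) = iter n dmul q + iter n dmul r.
Proof. by elim: n => //= n ->; rewrite dmulD. Qed.

Lemma wmulDl : left_distributive wmul +%R.
Proof.
move=> p q r; set n := maxn (size p) (size q).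
rewrite (@wmulE n (p + q)) ?size_polyD // (@wmulE n p) ?leq_maxl //.
rewrite (@wmulE n q) ?leq_maxr // -big_split /=; apply: eq_bigr => i _.
by rewrite coefD scalerDl.
Qed.

Lemma wmulDr : right_distributive wmul +%R.
Proof.
move=> p q r; rewrite /wmul -big_split /=; apply: eq_bigr => i _.
by rewrite iter_dmulD scalerDr.
Qed.

Lemma wmulZl a p q : wmul (a *: p) q = a *: wmul p q.
Proof.
rewrite (@wmulE (size p)) ?size_scale_leq // /wmul scaler_sumr.
by apply: eq_bigr => i _; rewrite coefZ scalerA.
Qed.

Lemma wmul_dmul q r : wmul (dmul q) r = dmul (wmul q r).
Proof.
rewrite wmulDl (@wmulE (size q) (map_poly _ q)); last exact: size_poly.
rewrite (@wmulE (size q).+1 (q * 'X)); last first.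
  by have [->|/size_mulX->//] := eqVneq q 0; rewrite mul0r size_poly0.
rewrite big_ord_recl coefMX scale0r add0r -big_split /= dmul_sum.
apply: eq_bigr => i _.
by rewrite coef_map_id0 ?deriv0 // coefMX /= dmulZ.
Qed.

Lemma wmul_iter n q r : wmul (iter n dmul q) r = iter n dmul (wmul q r).
Proof. by elim: n => //= n IHn; rewrite wmul_dmul IHn. Qed.

Lemma wmul0l r : wmul 0 r = 0.
Proof. by rewrite /wmul size_poly0 big_ord0. Qed.

Lemma wmul_suml I (s : seq I) (F : I -> W) r :
  wmul (\sum_(i <- s) F i) r = \sum_(i <- s) wmul (F i) r.
Proof. exact: (big_morph (wmul^~ r) (fun u v => wmulDl u v r) (wmul0l r)). Qed.

Lemma wmulA : associative wmul.
Proof.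
move=> p q r; transitivity (\sum_(i < size p) wmul (p`_i *: iter i dmul q) r).
  by rewrite {1}/wmul; apply: eq_bigr => i _; rewrite wmulZl wmul_iter.
by rewrite -wmul_suml.
Qed.

Lemma wmul1l : left_id 1 wmul.
Proof. by move=> q; rewrite /wmul size_poly1 big_ord1 coefC eqxx scale1r. Qed.

Lemma wmul1r : right_id 1 wmul.
Proof.
move=> p; have iterX n : iter n dmul 1 = 'X^n :> W.
  elim: n => [|n IHn] //=; rewrite IHn /dmul exprSr.
  rewrite (_ : map_poly _ _ = 0) ?add0r //; apply/polyP=> i.
  by rewrite coef_map_id0 ?deriv0 // coefXn coef0; case: eqP; rewrite ?derivC ?deriv0.
by rewrite /wmul -[RHS]coefK poly_def; apply: eq_bigr => i _; rewrite iterX.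
Qed.

Lemma wmulZr (c : R) p q : wmul p (c%:P *: q) = c%:P *: wmul p q.
Proof.
have dmulc r : dmul (c%:P *: r) = c%:P *: dmul r.
  by rewrite dmulZ derivC scale0r add0r.
have iterc n : iter n dmul (c%:P *: q) = c%:P *: iter n dmul q.
  by elim: n => //= n ->; rewrite dmulc.
rewrite /wmul scaler_sumr; apply: eq_bigr => i _.
by rewrite iterc !scalerA mulrC.
Qed.

Definition weyl_mul (u v : weyl R) := Weyl (wmul (weyl_coef u) (weyl_coef v)).

Fact weyl_mulA : associative weyl_mul.
Proof. by move=> u v w; apply: weyl_coef_inj; rewrite /= wmulA. Qed.
Fact weyl_mul1l : left_id (Weyl 1) weyl_mul.
Proof. by move=> u; apply: weyl_coef_inj; rewrite /= wmul1l. Qed.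
Fact weyl_mul1r : right_id (Weyl 1) weyl_mul.
Proof. by move=> u; apply: weyl_coef_inj; rewrite /= wmul1r. Qed.
Fact weyl_mulDl : left_distributive weyl_mul +%R.
Proof. by move=> u v w; apply: weyl_coef_inj; rewrite /= wmulDl. Qed.
Fact weyl_mulDr : right_distributive weyl_mul +%R.
Proof. by move=> u v w; apply: weyl_coef_inj; rewrite /= wmulDr. Qed.
Fact weyl_1_neq0 : Weyl 1 != 0 :> weyl R.
Proof. by rewrite -(inj_eq weyl_coef_inj) oner_neq0. Qed.

HB.instance Definition _ := GRing.Zmodule_isNzRing.Build (weyl R)
  weyl_mulA weyl_mul1l weyl_mul1r weyl_mulDl weyl_mulDr weyl_1_neq0.

Definition weyl_scale (c : R) (u : weyl R) := Weyl (c%:P *: weyl_coef u).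

Fact weyl_scaleA b c u : weyl_scale b (weyl_scale c u) = weyl_scale (b * c) u.
Proof. by apply: weyl_coef_inj; rewrite /= scalerA polyCM. Qed.
Fact weyl_scale1 : left_id 1 weyl_scale.
Proof. by move=> u; apply: weyl_coef_inj; rewrite /= scale1r. Qed.
Fact weyl_scaleDr : right_distributive weyl_scale +%R.
Proof. by move=> c u v; apply: weyl_coef_inj; rewrite /= scalerDr. Qed.
Fact weyl_scaleDl u : {morph weyl_scale^~ u : b c / b + c}.
Proof. by move=> b c; apply: weyl_coef_inj; rewrite /= polyCD scalerDl. Qed.

HB.instance Definition _ := GRing.Zmodule_isLmodule.Build R (weyl R)
  weyl_scaleA weyl_scale1 weyl_scaleDr weyl_scaleDl.

Fact weyl_scaleAl (c : R) (u v : weyl R) : c *: (u * v) = (c *: u) * v.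
Proof. by apply: weyl_coef_inj; rewrite /= wmulZl. Qed.
Fact weyl_scaleAr (c : R) (u v : weyl R) : c *: (u * v) = u * (c *: v).
Proof. by apply: weyl_coef_inj; rewrite /= wmulZr. Qed.

HB.instance Definition _ := GRing.Lmodule_isLalgebra.Build R (weyl R) weyl_scaleAl.
HB.instance Definition _ := GRing.Lalgebra_isAlgebra.Build R (weyl R) weyl_scaleAr.

Definition mulop a : weyl R := Weyl a%:P.
Definition dx : weyl R := Weyl 'X.

(** The product of [weyl R] is composition of operators. *)
Definition weyl_polyact (S : weyl R) (f : {poly R}) : {poly R} :=
  \sum_(t < size (weyl_coef S)) (weyl_coef S)`_t * f^`(t).

Lemma weyl_polyactE n (S : weyl R) f : (size (weyl_coef S) <= n)%N ->
  weyl_polyact S f = \sum_(t < n) (weyl_coef S)`_t * f^`(t).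
Proof.
case: S => p /= le_pn.
rewrite /weyl_polyact (big_ord_widen _ (fun t => p`_t * f^`(t)) le_pn).
rewrite big_mkcond /=; apply: eq_bigr => i _; case: ltnP => // le_pi.
by rewrite nth_default // mul0r.
Qed.

Lemma weyl_polyact_mulop a f : weyl_polyact (mulop a) f = a * f.
Proof.
by rewrite (@weyl_polyactE 1) ?size_polyC_leq1 // big_ord1 coefC eqxx derivn0.
Qed.

Lemma weyl_polyact_dx f : weyl_polyact dx f = f^`().
Proof.
rewrite /weyl_polyact size_polyX big_ord_recr big_ord1 /= !coefX.
by rewrite mul0r add0r mul1r.
Qed.

Lemma weyl_polyactD f : {morph weyl_polyact^~ f : S T / S + T}.
Proof.
move=> [p] [q]; set n := maxn (size p) (size q).
rewrite !(@weyl_polyactE n) ?leq_maxl ?leq_maxr ?size_polyD // -big_split /=.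
by apply: eq_bigr => i _; rewrite coefD mulrDl.
Qed.

Lemma weyl_polyactM (S T : weyl R) f :
  weyl_polyact (S * T) f = weyl_polyact S (weyl_polyact T f).
Proof.
pose act p := weyl_polyact (Weyl p) f.
have actD : {morph act : p q / p + q} by move=> p q; exact: (weyl_polyactD f (Weyl p) (Weyl q)).
have act0 : act 0 = 0 by rewrite /act /weyl_polyact size_poly0 big_ord0.
have actZ a p : act (a *: p) = a * act p.
  rewrite /act (@weyl_polyactE (size p)) ?size_scale_leq // mulr_sumr.
  by apply: eq_bigr => i _; rewrite coefZ mulrA.
have act_dmul p : act (dmul p) = (act p)^`().
  rewrite actD {1}/act (@weyl_polyactE (size p)) ?size_poly //.
  rewrite /act (@weyl_polyactE (size p).+1) /=; last first.
    by have [->|/size_mulX->//] := eqVneq p 0; rewrite mul0r size_poly0.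
  rewrite big_ord_recl coefMX mul0r add0r -big_split /= raddf_sum.
  apply: eq_bigr => i _.
  by rewrite coef_map_id0 ?deriv0 // coefMX /= derivM.
have act_iter n p : act (iter n (@dmul) p) = (act p)^`(n).
  by elim: n => [|n IHn]; rewrite ?derivn0 // iterS act_dmul IHn derivnS.
case: S T => [p] [q]; rewrite -[LHS]/(act (wmul p q)) /wmul (big_morph act actD act0).
by apply: eq_bigr => i _; rewrite actZ act_iter.
Qed.

End WeylAlgebra.

Section Modules.
Variables (B : pzRingType) (V : lmodType B).
Implicit Types (X U : set V) (s : seq V).

Definition submodule U := U 0 /\ forall a u v, U u -> U v -> U (a *: u + v).

Definition lspan X : set V := [set v | exists n (c : 'I_n -> B) (x : 'I_n -> V),
  (forall i, X (x i)) /\ v = \sum_(i < n) c i *: x i].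

Definition lfree s := forall c : nat -> B,
  \sum_(i < size s) c i *: s`_i = 0 -> forall i, (i < size s)%N -> c i = 0.

Definition is_basis X U :=
  [/\ X `<=` U, U `<=` lspan X
    & forall s, uniq s -> [set` s] `<=` X -> lfree s].

Definition has_dim U n :=
  exists s, [/\ size s = n, lfree s & U = lspan [set` s]].

Definition fin_gen := exists s, lspan [set` s] = setT.

Definition cyclic_module := exists v : V, forall u, exists a, u = a *: v.

Section SubQuotient.
Variables (U : set V) (hU : submodule U).

Definition submod_pred of submodule U : V -> bool := fun v => v \in U.

Fact submod_pred_closed : submod_closed (submod_pred hU).
Proof.
case: (hU) => U0 Ulin; split; first exact/mem_set.
by move=> a u v /set_mem Uu /set_mem Uv; exact/mem_set/Ulin.
Qed.

HB.instance Definition _ :=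
  GRing.isSubmodClosed.Build B V (submod_pred hU) submod_pred_closed.

Definition submod := {v : V | v \in submod_pred hU}.
HB.instance Definition _ := SubChoice.on submod.
HB.instance Definition _ := [SubChoice_isSubLmodule of submod by <:].

Definition submod_zmodClosed : zmodClosed V := GRing.ZmodClosed.clone V (submod_pred hU) _.
Definition quotmod : Type := Quotient.quot submod_zmodClosed.
HB.instance Definition _ := GRing.Zmodule.on quotmod.

Local Open Scope quotient_scope.

Local Notation piU := (\pi_(Quotient.quot submod_zmodClosed) : V -> quotmod).

Definition quotmod_scale (a : B) (q : quotmod) : quotmod :=
  piU (a *: repr (q : Quotient.quot submod_zmodClosed)).

Fact quotmod_scaleE a v : quotmod_scale a (piU v) = piU (a *: v).
Proof.
apply/eqP; rewrite -Quotient.idealrBE -scalerBr rpredZ //.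
by rewrite Quotient.idealrBE reprK.
Qed.

Fact quotmod_piD : {morph piU : u v / u + v}.
Proof. by move=> u v; exact: Quotient.pi_add. Qed.

Fact quotmod_piP q : exists v, q = piU v.
Proof. by exists (repr (q : Quotient.quot submod_zmodClosed)); rewrite reprK. Qed.

Fact quotmod_scaleA a b q :
  quotmod_scale a (quotmod_scale b q) = quotmod_scale (a * b) q.
Proof. by have [v ->] := quotmod_piP q; rewrite !quotmod_scaleE scalerA. Qed.
Fact quotmod_scale1 : left_id 1 quotmod_scale.
Proof. by move=> q; have [v ->] := quotmod_piP q; rewrite quotmod_scaleE scale1r. Qed.
Fact quotmod_scaleDr : right_distributive quotmod_scale +%R.
Proof.
move=> a q r; have [u ->] := quotmod_piP q; have [v ->] := quotmod_piP r.
by rewrite -quotmod_piD !quotmod_scaleE scalerDr quotmod_piD.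
Qed.
Fact quotmod_scaleDl q : {morph quotmod_scale^~ q : a b / a + b}.
Proof.
move=> a b; have [v ->] := quotmod_piP q.
by rewrite !quotmod_scaleE scalerDl quotmod_piD.
Qed.

HB.instance Definition _ := GRing.Zmodule_isLmodule.Build B quotmod
  quotmod_scaleA quotmod_scale1 quotmod_scaleDr quotmod_scaleDl.

End SubQuotient.
End Modules.

Section RightIdeals.
Variable A : nzRingType.
Implicit Types (I J : set A) (g : A).

Definition right_ideal I :=
  [/\ I 0, forall u v, I u -> I v -> I (u + v) & forall u a, I u -> I (u * a)].

Definition right_multiples g : set A := [set g * a | a in setT].

Definition principal_right_ideal I :=
  right_ideal I /\ exists g, I = right_multiples g.

Definition maximal_right_ideal I := [/\ right_ideal I, I <> setT
  & forall J, right_ideal J -> I `<=` J -> J = I \/ J = setT].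

(** Right [A]-modules are left modules over the converse ring [A^c]; in
    particular [(A^c)^o] is [A] acting on itself by right multiplication. *)
Lemma right_ideal_submodule I : right_ideal I -> submodule (I : set (A^c)^o).
Proof. by case=> I0 ID IM; split=> // a u v Iu Iv; apply: ID => //; exact: IM. Qed.

Definition ideal_mod I (hI : right_ideal I) : lmodType A^c :=
  submod (right_ideal_submodule hI).
Definition ideal_quot I (hI : right_ideal I) : lmodType A^c :=
  quotmod (right_ideal_submodule hI).

End RightIdeals.

Section Bernstein.
Variable R : realType.
Local Notation A := (weyl R).

Definition bernstein (n : nat) : set A :=
  lspan [set S | exists a b, (a + b <= n)%N /\ S = mulop 'X^a * dx R ^+ b].

Section OneModule.
Variable M : lmodType A^c.

(** Restriction of scalars along [c |-> c%:A]. *)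
Definition real_mod : Type := M.
HB.instance Definition _ := GRing.Zmodule.on real_mod.

Definition real_scale (c : R) (m : real_mod) : real_mod := (c%:A : A^c) *: (m : M).

Fact real_scaleA b c m : real_scale b (real_scale c m) = real_scale (b * c) m.
Proof.
rewrite /real_scale scalerA; congr (_ *: _).
by rewrite -[LHS]/((c%:A : A) * b%:A) -scalerAl mul1r scalerA mulrC.
Qed.
Fact real_scale1 : left_id 1 real_scale.
Proof. by move=> m; rewrite /real_scale scale1r -[RHS]scale1r. Qed.
Fact real_scaleDr : right_distributive real_scale +%R.
Proof. by move=> c u v; rewrite /real_scale -scalerDr. Qed.
Fact real_scaleDl m : {morph real_scale^~ m : b c / b + c}.
Proof. by move=> b c; rewrite /real_scale scalerDl -[RHS]scalerDl. Qed.

HB.instance Definition _ := GRing.Zmodule_isLmodule.Build R real_mod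
  real_scaleA real_scale1 real_scaleDr real_scaleDl.

Implicit Type G : nat -> set M.

Definition filtration G :=
  [/\ forall n, G n `<=` G n.+1,
      forall n, exists k, has_dim (G n : set real_mod) k,
      \bigcup_n G n = setT
    & forall k n m (a : A), G n m -> bernstein k a -> G (n + k)%N ((a : A^c) *: m)].

(** The elements of [G_0 (+) G_1/G_0 (+) G_2/G_1 (+) ...] are given by finitely
    supported families [u] of representatives, [u n] lying in [G n]; two families
    represent the same element when they satisfy [gr_eq]. *)
Definition gr_elt (V : zmodType) (F : nat -> set V) (u : nat -> V) :=
  (forall n, F n (u n)) /\ exists n0, forall n, (n0 <= n)%N -> u n = 0.

Definition gr_eq (V : zmodType) (F : nat -> set V) (u v : nat -> V) :=
  forall n, (if n is n'.+1 then F n' else [set 0]) (u n - v n).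

(** Action of the graded ring: the component of degree [n] of [u a] is
    [\sum_(i + j = n) u_i a_j]. *)
Definition gr_act (u : nat -> M) (a : nat -> A) : nat -> M :=
  fun n => \sum_(i < n.+1) (a (n - i)%N : A^c) *: u i.

Definition gr_fin_gen G := exists k (g : 'I_k -> nat -> M),
  (forall j, gr_elt G (g j)) /\
  forall u, gr_elt G u -> exists a : 'I_k -> nat -> A,
    (forall j, gr_elt bernstein (a j)) /\
    gr_eq G u (fun n => \sum_(j < k) gr_act (g j) (a j) n).

Definition good_filtration G := filtration G /\ gr_fin_gen G.

Definition hilbert_degree G (deg : nat) := exists p : {poly R},
  (size p).-1 = deg /\
  exists n0, forall n, (n0 <= n)%N ->
    exists2 k, has_dim (G n : set real_mod) k & k%:R = p.[n%:R].

(** The common degree of the Hilbert polynomials of the good filtrations of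
    [M] ([0] if [M] has no good filtration). *)
Definition bernstein_dim : nat := xget 0%N
  [set deg | exists2 G, good_filtration G & hilbert_degree G deg].

Definition holonomic := fin_gen M /\ bernstein_dim = 1%N.

End OneModule.
End Bernstein.

Inductive test_class :=
  Schwartz | Polynomials | PolynomialGrowth | OperatorDependent.

Section Stein.
Variable R : realType.
Implicit Types (f : R -> R) (S : weyl R).

Definition weyl_order S : nat := (size (weyl_coef S)).-1.

Definition weyl_xdeg S : nat :=
  \max_(t < size (weyl_coef S)) (size ((weyl_coef S)`_t)%R).-1.

Definition weyl_act S f : R -> R :=
  fun x => \sum_(t < size (weyl_coef S)) ((weyl_coef S)`_t).[x] * derive1n t f x.

Definition Ck (k : nat) f :=
  (forall t, (t < k)%N -> forall x, derivable (derive1n t f) x 1) /\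
  continuous (derive1n k f).

Definition smooth f := forall k, Ck k f.

Definition schwartz : set (R -> R) := [set f | smooth f /\
  forall a b, exists C, forall x, `|x ^+ a * derive1n b f x| <= C].

Definition polynomial_functions : set (R -> R) :=
  [set f | exists p : {poly R}, f = horner p].

(** All derivatives have polynomial growth.  The weight is [1 + |x|^a] rather than
    [1 + x^a], which vanishes at [-1] for odd [a]; the class is the same since the
    exponent may be increased to an even one. *)
Definition poly_growth : set (R -> R) := [set f | smooth f /\
  forall b, exists2 a, (1 <= a)%N &
    exists C, forall x, `|(1 + `|x| ^+ a)^-1 * derive1n b f x| <= C].

Section RandomVariable.
Context {d : measure_display} {T : measurableType d} (P : probability T R).
Variable X : {RV P >-> R}.

(** The class of the [f] in [C^T(R)] such that [E|X^j f^(t)(X)|] is finite for all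
    [j <= max_t deg p_t] and [t <= T], for a variable [X] whose support is the
    whole line.  [T] is the order of the operator, except that operators are
    written with [T >= 1]. *)
Definition integrable_class S : set (R -> R) :=
  [set f | Ck (maxn 1 (weyl_order S)) f /\
    forall j t, (j <= weyl_xdeg S)%N -> (t <= maxn 1 (weyl_order S))%N ->
      P.-integrable setT (fun w => (X w ^+ j * derive1n t f (X w))%:E)].

Definition test_functions (c : test_class) S : set (R -> R) :=
  match c with
  | Schwartz => schwartz
  | Polynomials => polynomial_functions
  | PolynomialGrowth => poly_growth
  | OperatorDependent => integrable_class S
  end.

(** Padding with zero coefficients, every element of [weyl R] is a sum over
    [t <= T] with [T >= 1]. *)
Definition PSO (c : test_class) : set (weyl R) :=
  [set S | forall f, test_functions c S f ->
    P.-integrable setT (EFin \o (weyl_act S f \o X)) /\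
    ('E_P[weyl_act S f \o X] = 0)%E].

End RandomVariable.

Fixpoint hermite (n : nat) : {poly R} :=
  if n is n'.+1 then 'X * hermite n' - (hermite n')^`() else 1.

Definition stein_hermite (k t : nat) : weyl R :=
  mulop (hermite k) * dx R ^+ t - mulop (hermite (k + t)).

Definition hermite_basis : set (weyl R) :=
  [set S | exists k t, (1 <= t)%N /\ S = stein_hermite k t].

End Stein.

Arguments hermite_basis : clear implicits.

(* Main.v *)
Require Import Defs.
From mathcomp Require Import all_boot all_order all_algebra.
From mathcomp Require Import all_classical all_reals all_analysis.
From mathcomp Require Import measurable_realfun.
From mathcomp Require Import zify ring lra.
From mathcomp Require polyrcf.

Set Implicit Arguments.
Unset Strict Implicit.
Unset Printing Implicit Defensive.

Import Order.TTheory GRing.Theory Num.Theory.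
Import numFieldNormedType.Exports.

Local Open Scope classical_set_scope.
Local Open Scope ring_scope.

(** Integration by parts against the Gaussian weight replaces each derivative by the
    creation operator [q |-> x q - q'], so that [E (S f)(N) = E (f s)(N)], where the
    polynomial [s = \sum_t (x - d)^t p_t] is the adjoint of [S = \sum_t p_t d^t] applied
    to [1].  Division on the left by [d - x] gives [S = (d - x) L + s], so [s = 0] exactly
    when [S] is a right multiple of [d - x]; and testing a Stein operator on [w s], with
    [w = 1] or, if decay is required, [w] the Gaussian density, gives [E (w s^2)(N) = 0],
    hence [s = 0].  Thus PSO(N) is the kernel of [S |-> s], which identifies the quotient with
    the polynomials.  On these [x - d] acts from the right as differentiation, whence
    maximality; the images of the Bernstein filtration are the polynomials of degree at
    most [n], of dimension [n + 1]; and PSO(N) itself is free on [d - x], so its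
    dimensions are those of the Weyl algebra. *)

(** * Spans and dimensions *)

Section Lspan.
Variables (B : pzRingType) (V : lmodType B).
Implicit Types (X U : set V).

Lemma lspan_sub X : X `<=` lspan X.
Proof.
move=> x Xx; exists 1%N, (fun=> 1), (fun=> x); split => //.
by rewrite big_ord1 scale1r.
Qed.

Lemma lspan0 X : lspan X 0.
Proof.
exists 0%N, (fun=> 0), (fun=> 0); rewrite big_ord0; split=> // -[].
by [].
Qed.

Lemma lspanD X u v : lspan X u -> lspan X v -> lspan X (u + v).
Proof.
move=> [m [a [x [Xx ->]]]] [n [b [y [Xy ->]]]].
exists (m + n)%N,
  (fun i => match fintype.split i with inl j => a j | inr j => b j end),
  (fun i => match fintype.split i with inl j => x j | inr j => y j end); split.
  by move=> i; case: (fintype.split i).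
rewrite big_split_ord /=; congr (_ + _); apply: eq_bigr => i _.
  by rewrite (unsplitK (inl i)).
by rewrite (unsplitK (inr i)).
Qed.

Lemma lspanZ X c v : lspan X v -> lspan X (c *: v).
Proof.
move=> [m [a [x [Xx ->]]]]; exists m, (fun i => c * a i), x; split => //.
by rewrite scaler_sumr; apply: eq_bigr => i _; rewrite scalerA.
Qed.

Lemma lspan_sum X I (r : seq I) (p : pred I) (F : I -> V) :
  (forall i, p i -> lspan X (F i)) -> lspan X (\sum_(i <- r | p i) F i).
Proof. by move=> h; apply: big_ind => //; [exact: lspan0|exact: lspanD]. Qed.

Lemma lspan_min X U : submodule U -> X `<=` U -> lspan X `<=` U.
Proof.
move=> [U0 Ulin] XU _ [n [c [x [Xx ->]]]].
elim/big_ind: _ => //= [u v Uu Uv|i _].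
  by rewrite -[u]scale1r; exact: Ulin.
by rewrite -[_ *: _]addr0; apply: Ulin => //; apply: XU.
Qed.

(** [lspan] admits repeated generators in any order; the sums over the positions of [s] form a
    submodule containing [s], which collects the repetitions. *)
Lemma lspan_seqP (s : seq V) v :
  lspan [set` s] v -> exists c : nat -> B, v = \sum_(i < size s) c i *: s`_i.
Proof.
move: v; apply: lspan_min.
  split=> [|a _ _ [c ->] [d ->]].
    by exists (fun=> 0); rewrite big1 // => i _; rewrite scale0r.
  exists (fun i => a * c i + d i); rewrite scaler_sumr -big_split /=.
  by apply: eq_bigr => i _; rewrite scalerDl scalerA.
move=> x /= xs; exists (fun i => (i == index x s)%:R).
have ixs : (index x s < size s)%N by rewrite index_mem.
rewrite (bigD1 (Ordinal ixs)) //= eqxx scale1r nth_index // big1 ?addr0 // => i.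
by rewrite -val_eqE /= => /negPf ->; rewrite scale0r.
Qed.

(** Lets a basis be indexed by any finite type, such as a triangle of exponents; enumerating the
    type yields the sequence that [has_dim] asks for. *)
Lemma has_dim_fin (I : finType) (f : I -> V) U :
  (forall c : I -> B, \sum_i c i *: f i = 0 -> forall i, c i = 0) ->
  U = [set \sum_i c i *: f i | c in [set: I -> B]] -> has_dim U #|I|.
Proof.
move=> f_free ->; exists [seq f i | i <- enum I].
have sum_enum (c : I -> B) (d : nat -> B) : (forall i, c i = d (enum_rank i)) ->
    \sum_(i < size [seq f i | i <- enum I]) d i *: [seq f i | i <- enum I]`_i
      = \sum_i c i *: f i.
  move=> cd; rewrite size_map -cardE [RHS](reindex _ (onW_bij _ (@enum_val_bij I))).
  apply: eq_bigr => i _; rewrite cd enum_valK; congr (_ *: _).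
  rewrite (nth_map (enum_val i)) -?cardE ?ltn_ord //; congr f.
  by rewrite -enum_val_nth.
split; first by rewrite size_map -cardE.
- move=> d; rewrite (sum_enum (fun i => d (enum_rank i))) // => /f_free d0 i.
  rewrite size_map -cardE => ltiI.
  by have := d0 (enum_val (Ordinal ltiI)); rewrite enum_valK.
- apply/seteqP; split=> [_ [c _ <-]|].
    apply: lspan_sum => i _; apply/lspanZ/lspan_sub => /=.
    by apply: map_f; rewrite mem_enum.
  move=> v /lspan_seqP[d ->]; exists (fun i => d (enum_rank i)) => //.
  by rewrite (sum_enum (fun i => d (enum_rank i))).
Qed.

End Lspan.

(** With more basis vectors in [U] than spanning vectors in [W], the matrix of coordinates has a
    nonzero vector in its left kernel, which is a linear relation in the basis of [U]. *)
Lemma has_dim_le (F : fieldType) (V : lmodType F) (U W : set V) m n :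
  has_dim U m -> has_dim W n -> U `<=` W -> (m <= n)%N.
Proof.
move=> [s [<- s_free ->]] [t [<- _ ->]] sub.
have /choice[c cE] (i : 'I_(size s)) :
    exists c : nat -> F, s`_i = \sum_(j < size t) c j *: t`_j.
  by apply/lspan_seqP/sub/lspan_sub => /=; rewrite mem_nth.
pose M := \matrix_(i < size s, j < size t) c i j.
rewrite leqNgt; apply/negP => lt_ts.
have /rowV0Pn[v v_ker] : kermx M != 0.
  by rewrite -mxrank_eq0 mxrank_ker subn_eq0 -ltnNge (leq_ltn_trans (rank_leq_col _)).
have /eqP vM0 : v *m M == 0 by apply/eqP/sub_kermxP.
(* [lfree] takes coefficients on all of [nat], so the row [v] is extended by 0. *)
pose a i := if insub i is Some j then v 0 j else 0.
have aE (i : 'I_(size s)) : a i = v 0 i by rewrite /a valK.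
case/eqP; apply/rowP => i; rewrite mxE -aE.
apply: s_free => //; under eq_bigr => j _ do rewrite cE scaler_sumr.
rewrite exchange_big /= big1 // => j _.
under eq_bigr => k _ do rewrite scalerA.
rewrite -scaler_suml.
have /rowP/(_ j) := vM0; rewrite !mxE => v0.
rewrite (_ : \sum_(_ < _) _ = 0) ?scale0r // -[RHS]v0.
by apply: eq_bigr => k _; rewrite aE mxE.
Qed.

Lemma has_dim0 (B : pzRingType) (V : lmodType B) (U : set V) n : has_dim U n -> U 0.
Proof. by move=> [s [_ _ ->]]; exact: lspan0. Qed.

Lemma has_dimD (B : pzRingType) (V : lmodType B) (U : set V) n u v :
  has_dim U n -> U u -> U v -> U (u + v).
Proof. by move=> [s [_ _ ->]]; exact: lspanD. Qed.

(** * The right ideal generated by d - x *)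

Lemma right_ideal_right_multiples (A : nzRingType) (g : A) :
  right_ideal (right_multiples g).
Proof.
split=> [|_ _ [a _ <-] [b _ <-]|_ b [a _ <-]].
- by exists 0; rewrite ?mulr0.
- by exists (a + b); rewrite ?mulrDr.
- by exists (a * b); rewrite ?mulrA.
Qed.

Section WeylCoef.
Variable R : comNzRingType.
Implicit Types (S T : weyl R) (q : {poly R}) (p : {poly {poly R}}).

Lemma weyl_coef_sum I (r : seq I) (P : pred I) (F : I -> weyl R) :
  weyl_coef (\sum_(i <- r | P i) F i) = \sum_(i <- r | P i) weyl_coef (F i).
Proof. exact: (big_morph (@weyl_coef R)). Qed.

Lemma coef_weyl_scale (c : R) S i j :
  (weyl_coef (c *: S))`_i`_j = c * (weyl_coef S)`_i`_j.
Proof. by rewrite coefZ mul_polyC coefZ. Qed.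

Lemma weyl_coef_mulop q S : weyl_coef (mulop q * S) = q *: weyl_coef S.
Proof.
rewrite /= (@wmulE _ 1) ?size_polyC_leq1 // big_ord1 coefC eqxx.
by [].
Qed.

Lemma weyl_coef_dx S : weyl_coef (dx R * S) = dmul (weyl_coef S).
Proof.
rewrite /= /wmul size_polyX big_ord_recl big_ord1 /= !coefX.
by rewrite scale0r add0r scale1r.
Qed.

Lemma dmulXn n : dmul ('X^n : {poly {poly R}}) = 'X^(n.+1).
Proof.
rewrite /dmul exprSr (_ : map_poly _ _ = 0) ?add0r //; apply/polyP=> i.
by rewrite coef_map_id0 ?deriv0 // coefXn coef0; case: eqP; rewrite ?derivC ?deriv0.
Qed.

Lemma weyl_coef_dxn n : weyl_coef (dx R ^+ n) = 'X^n.
Proof. by elim: n => // n IHn; rewrite exprS weyl_coef_dx IHn dmulXn. Qed.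

Lemma weyl_coef_mulop_dxn q n : weyl_coef (mulop q * dx R ^+ n) = q *: 'X^n.
Proof. by rewrite weyl_coef_mulop weyl_coef_dxn. Qed.

Lemma mulopM q r : mulop (q * r) = mulop q * mulop r.
Proof.
apply: weyl_coef_inj; rewrite weyl_coef_mulop /=.
by rewrite -mul_polyC -polyCM.
Qed.

Lemma mulopD q r : mulop (q + r) = mulop q + mulop r.
Proof. by apply: weyl_coef_inj; rewrite /= polyCD. Qed.

Lemma mulop0 : mulop 0 = 0 :> weyl R.
Proof. exact: weyl_coef_inj. Qed.

Lemma mulopZ (c : R) q : mulop (c *: q) = c *: mulop q.
Proof. by apply: weyl_coef_inj; rewrite /= -mul_polyC polyCM mul_polyC. Qed.

Lemma mulop_sum I (r : seq I) (P : pred I) (F : I -> {poly R}) :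
  mulop (\sum_(i <- r | P i) F i) = \sum_(i <- r | P i) mulop (F i).
Proof. exact: (big_morph (@mulop R) mulopD mulop0). Qed.

Lemma weyl_sumE S :
  S = \sum_(t < size (weyl_coef S)) mulop (weyl_coef S)`_t * dx R ^+ t.
Proof.
apply: weyl_coef_inj; rewrite weyl_coef_sum -[LHS]coefK poly_def.
by apply: eq_bigr => t _; rewrite weyl_coef_mulop_dxn.
Qed.

Lemma coef_dmul p t :
  (dmul p)`_t = (p`_t)^`() + (if t is t'.+1 then p`_t' else 0).
Proof.
by rewrite /dmul coefD coefMX coef_map_id0 ?deriv0 //; case: t.
Qed.

Lemma size_weyl_coef_dx k S : (size (weyl_coef S) <= k)%N ->
  (size (weyl_coef (dx R * S)%R) <= k.+1)%N.
Proof.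
move=> le_Sk; rewrite weyl_coef_dx /dmul (leq_trans (size_polyD _ _)) // geq_max.
apply/andP; split; first exact: leq_trans (size_poly _ _) (leqW le_Sk).
by rewrite (leq_trans (size_polyMleq _ _)) // size_polyX addn2.
Qed.

Definition stein_op : weyl R := dx R - mulop 'X.

Lemma weyl_coef_stein_op S :
  weyl_coef (stein_op * S) = dmul (weyl_coef S) - 'X *: weyl_coef S.
Proof. by rewrite mulrBl -weyl_coef_dx -weyl_coef_mulop. Qed.

(** The formal adjoint of [d] for the Gaussian weight [phi]: the derivative of [q phi] is
    [- creation q] times [phi]. Iterated on 1 it produces the Hermite polynomials. *)
Definition creation q := 'X * q - q^`().

Lemma iter_creationD n : {morph iter n creation : q r / q + r}.
Proof.
move=> q r; elim: n => //= n ->.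
by rewrite /creation mulrDr derivD opprD addrACA.
Qed.

Lemma iter_creationZ n c q : iter n creation (c *: q) = c *: iter n creation q.
Proof. by elim: n => //= n ->; rewrite /creation -scalerAr derivZ scalerBr. Qed.

Lemma iter_creation0 n : iter n creation 0 = 0.
Proof. by have := iter_creationZ n 0 0; rewrite scale0r => ->; rewrite scale0r. Qed.

(** Moving all derivatives onto the Gaussian weight turns [E (S f)(N)] into
    [E (f * gauss_adjoint S)(N)]. *)
Definition gauss_adjoint S : {poly R} :=
  \sum_(t < size (weyl_coef S)) iter t creation (weyl_coef S)`_t.

Lemma gauss_adjointE n S : (size (weyl_coef S) <= n)%N ->
  gauss_adjoint S = \sum_(t < n) iter t creation (weyl_coef S)`_t.
Proof.
move=> le_Sn; rewrite /gauss_adjoint.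
rewrite (big_ord_widen _ (fun t => iter t creation (weyl_coef S)`_t) le_Sn).
rewrite big_mkcond /=; apply: eq_bigr => i _; case: ltnP => // le_Si.
by rewrite nth_default // iter_creation0.
Qed.

Lemma gauss_adjointD : {morph gauss_adjoint : S T / S + T}.
Proof.
move=> S T; set n := maxn (size (weyl_coef S)) (size (weyl_coef T)).
rewrite !(@gauss_adjointE n) ?leq_maxl ?leq_maxr ?size_polyD // -big_split /=.
by apply: eq_bigr => i _; rewrite coefD iter_creationD.
Qed.

Lemma gauss_adjointZ c S : gauss_adjoint (c *: S) = c *: gauss_adjoint S.
Proof.
rewrite (@gauss_adjointE (size (weyl_coef S))); last exact: size_scale_leq.
rewrite /gauss_adjoint scaler_sumr; apply: eq_bigr => i _.
by rewrite -iter_creationZ; congr iter; rewrite coefZ mul_polyC.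
Qed.

Lemma gauss_adjoint0 : gauss_adjoint 0 = 0.
Proof. by rewrite /gauss_adjoint size_poly0 big_ord0. Qed.

Lemma gauss_adjointB S T : gauss_adjoint (S - T) = gauss_adjoint S - gauss_adjoint T.
Proof. by rewrite gauss_adjointD -scaleN1r gauss_adjointZ scaleN1r. Qed.

Lemma gauss_adjoint_mulop_dxn q n :
  gauss_adjoint (mulop q * dx R ^+ n) = iter n creation q.
Proof.
rewrite (@gauss_adjointE n.+1) weyl_coef_mulop_dxn; last first.
  by rewrite (leq_trans (size_scale_leq _ _)) ?size_polyXn.
rewrite big_ord_recr /= big1 ?add0r => [|i _]; rewrite coefZ coefXn.
  by rewrite eqxx mulr1.
by rewrite ltn_eqF // mulr0 iter_creation0.
Qed.

Lemma gauss_adjoint_mulop q : gauss_adjoint (mulop q) = q.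
Proof. by rewrite -[mulop q]mulr1 -(expr0 (dx R)) gauss_adjoint_mulop_dxn. Qed.

(** By the Leibniz rule [d q = q d + q']. Hence, modulo right multiples of [d - x], a factor [d] can
    be traded for one [creation] on the coefficient. *)
Lemma stein_op_mulop_dxn q n :
  stein_op * (mulop q * dx R ^+ n) =
  mulop q * dx R ^+ n.+1 - mulop (creation q) * dx R ^+ n.
Proof.
apply: weyl_coef_inj; rewrite weyl_coef_stein_op.
rewrite -[RHS]/(weyl_coef (_ * _) - weyl_coef (_ * _)).
rewrite !weyl_coef_mulop_dxn dmulZ dmulXn.
by rewrite /creation scalerBl scalerA opprB addrCA addrA.
Qed.

Lemma gauss_adjoint_stein_op S : gauss_adjoint (stein_op * S) = 0.
Proof.
rewrite [S]weyl_sumE mulr_sumr (big_morph _ gauss_adjointD gauss_adjoint0).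
rewrite big1 // => t _.
by rewrite stein_op_mulop_dxn gauss_adjointB !gauss_adjoint_mulop_dxn iterSr subrr.
Qed.

(** Left division by [d - x] with a remainder of order 0: on each term [q d^n] the factors [d] are
    traded one by one for [creation]. *)
Lemma gauss_adjoint_decomp S :
  exists L, S = stein_op * L + mulop (gauss_adjoint S).
Proof.
have dec q n : exists L, mulop q * dx R ^+ n = stein_op * L + mulop (iter n creation q).
  elim: n q => [|n IHn] q; first by exists 0; rewrite mulr0 add0r mulr1.
  have [L LE] := IHn (creation q); exists (mulop q * dx R ^+ n + L).
  by rewrite mulrDr -addrA iterSr -LE stein_op_mulop_dxn subrK.
have /choice[L LE] t := dec (weyl_coef S)`_t t.
exists (\sum_(t < size (weyl_coef S)) L t).
by rewrite mulr_sumr mulop_sum -big_split /= {1}[S]weyl_sumE; exact: eq_bigr.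
Qed.

Lemma gauss_adjoint_eq0 S : gauss_adjoint S = 0 <-> exists L, S = stein_op * L.
Proof.
split=> [S0|[L ->]]; last exact: gauss_adjoint_stein_op.
by have [L] := gauss_adjoint_decomp S; rewrite S0 mulop0 addr0; exists L.
Qed.

(** The shift [weyl_coef S * 'X] dominates the other terms, which do not raise the order. This
    yields injectivity below and tells how many derivatives [L f] needs. *)
Lemma size_weyl_coef_stein_op S : S != 0 ->
  size (weyl_coef (stein_op * S)) = (size (weyl_coef S)).+1.
Proof.
move=> S0; have p0 : weyl_coef S != 0.
  by apply: contra_neq S0 => S0; exact: weyl_coef_inj.
rewrite weyl_coef_stein_op /dmul addrAC addrC size_polyDl size_mulX // ltnS.
rewrite (leq_trans (size_polyD _ _)) // geq_max size_polyN.
by rewrite size_poly size_scale_leq.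
Qed.

Lemma stein_op_inj : injective ( *%R stein_op).
Proof.
move=> S T /eqP; rewrite -subr_eq0 -mulrBr => /eqP ST0.
apply/eqP; rewrite -subr_eq0; apply: contraT => /size_weyl_coef_stein_op.
by rewrite ST0 size_poly0.
Qed.

Lemma right_multiples_stein_op :
  right_multiples stein_op = [set S | gauss_adjoint S = 0].
Proof.
apply/seteqP; split=> S /= [].
  by move=> L _ <-; exact: gauss_adjoint_stein_op.
by case/gauss_adjoint_eq0 => L ->; exists L.
Qed.

End WeylCoef.

(** A right ideal [J] not contained in the kernel of [gauss_adjoint] contains multiplication by a
    nonzero polynomial. Repeated differentiation, which [J] allows, ends in a nonzero constant, a
    unit. *)
Lemma maximal_right_ideal_stein_op (R : realType) :
  maximal_right_ideal (right_multiples (stein_op R)).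
Proof.
split; first exact: right_ideal_right_multiples.
  rewrite right_multiples_stein_op => /seteqP[_ /(_ (mulop 1) I)] /=.
  by rewrite gauss_adjoint_mulop => /eqP; rewrite oner_eq0.
rewrite right_multiples_stein_op => J [J0 JD JM] subJ.
have [?|/existsNP[S /not_implyP[JS S0]]] :=
    pselect (J `<=` [set S | gauss_adjoint S = 0]); first by left; apply/seteqP.
right; apply/seteqP; split => // S' _; rewrite -[S']mul1r; apply: (JM).
(* [S] and multiplication by its adjoint differ by an element of the kernel, hence of [J]. *)
have Jq : J (mulop (gauss_adjoint S)).
  rewrite -[mulop _](subrKC S); apply: (JD) => //; apply: subJ => /=.
  by rewrite gauss_adjointB gauss_adjoint_mulop subrr.
move/eqP: S0; move: (gauss_adjoint S) Jq => q; have [n] := ubnP (size q).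
elim: n q => // n IHn q; rewrite ltnS => le_qn Jq q0.
have [/size1_polyC qE|lt1q] := leqP (size q) 1.
  have c0 : q`_0 != 0 by apply: contra_neq q0 => c0; rewrite qE c0.
  rewrite (_ : 1 = mulop q * mulop (q`_0)^-1%:P); first exact: JM.
  by rewrite -mulopM {1}qE -polyCM mulfV.
have q'0 : q^`() != 0.
  apply: contraTneq lt1q => /polyP/(_ (size q).-2); rewrite coef_deriv coef0.
  move: q0; rewrite -lead_coef_eq0 /lead_coef.
  by case: (size q) => [|[|m]] //= /negPf lead0 /eqP; rewrite mulrn_eq0 lead0.
apply: (IHn q^`()) => //; first exact: leq_trans (lt_size_deriv q0) le_qn.
(* The adjoint of [q (x - d)] is [q x - creation q = q'], so multiplication by [q'] lies in [J] up
   to an element of the kernel. *)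
rewrite -[mulop _](subrK (mulop q * (mulop 'X - dx R))); apply: (JD); last exact: JM.
apply: subJ => /=; rewrite mulrBr -mulopM -[dx R]expr1.
rewrite !gauss_adjointB !gauss_adjoint_mulop gauss_adjoint_mulop_dxn /= /creation.
by rewrite mulrC subKr subrr.
Qed.

(** * The Hermite basis *)

Section HermiteBasis.
Variable R : realType.
Local Notation B := (hermite_basis R).

Lemma hermiteE n : hermite R n = iter n (@creation R) 1.
Proof. by elim: n => //= n ->. Qed.

Lemma hermiteD k t : hermite R (k + t) = iter t (@creation R) (hermite R k).
Proof. by rewrite !hermiteE addnC iterD. Qed.

Lemma size_lead_hermite n :
  size (hermite R n) = n.+1 /\ (hermite R n)`_n = 1.
Proof.
elim: n => [|n [szH leadH]]; first by rewrite /= size_poly1 coefC.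
have H0 : hermite R n != 0 by rewrite -size_poly_eq0 szH.
split; rewrite /=.
  rewrite mulrC size_polyDl size_mulX ?szH // size_polyN.
  by rewrite (ltn_trans (lt_size_deriv H0)) // szH.
rewrite coefB coefXM leadH coef_deriv nth_default ?mul0rn ?subr0 //.
by rewrite szH leqnSn.
Qed.

Lemma gauss_adjoint_stein_hermite k t : gauss_adjoint (stein_hermite R k t) = 0.
Proof.
rewrite /stein_hermite gauss_adjointB gauss_adjoint_mulop gauss_adjoint_mulop_dxn.
by rewrite hermiteD subrr.
Qed.

(** Since [H_n] is monic of degree [n], subtracting [q_n H_n] lowers the degree. This serves as an
    induction principle for linear properties of polynomials. *)
Lemma hermite_span (P : {poly R} -> Prop) :
  (forall c q r, P q -> P r -> P (c *: q + r)) -> (forall n, P (hermite R n)) ->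
  forall q, P q.
Proof.
move=> Plin PH q; have [n] := ubnP (size q); elim: n q => // n IHn q.
rewrite ltnS => le_qn; have P0 : P 0.
  by have := Plin (-1) _ _ (PH 0%N) (PH 0%N); rewrite scaleN1r addNr.
case: n IHn le_qn => [_|n IHn le_qn].
  by rewrite leqn0 size_poly_eq0 => /eqP ->.
rewrite -[q](subrKC (q`_n *: hermite R n)); apply: Plin => //.
have [szH leadH] := size_lead_hermite n.
apply: IHn; rewrite ltnS; apply/leq_sizeP => j; rewrite leq_eqVlt => /predU1P[<-|ltnj].
  by rewrite coefB coefZ leadH mulr1 subrr.
rewrite coefB coefZ (nth_default _ (leq_trans le_qn ltnj)).
by rewrite [(hermite R n)`_j]nth_default ?szH // mulr0 subr0.
Qed.

(** The expression is linear in [q], and for [q = H_k] it is the basis element [S(k,t)]. *)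
Lemma mulop_dxn_in_hermite_span q t : (1 <= t)%N ->
  lspan B (mulop q * dx R ^+ t - mulop (iter t (@creation R) q)).
Proof.
move=> lt0t; pose D q := mulop q * dx R ^+ t - mulop (iter t (@creation R) q).
apply: (@hermite_span (fun q => lspan B (D q))) => [c q1 r Bq Br|k]; rewrite /D.
  rewrite iter_creationD iter_creationZ !mulopD !mulopZ mulrDl -scalerAl.
  by rewrite opprD addrACA -scalerBr; apply/lspanD/Br/lspanZ.
by apply: lspan_sub; exists k, t; rewrite /stein_hermite hermiteD.
Qed.

(** For [t >= 1] the coefficient of [d^t] in [S(k,t)] is [H_k], because [H_(k+t)] only enters at
    order 0. In a relation, take a term with nonzero coefficient and largest [k]: no other term
    contributes to [x^k d^t]. *)
Lemma lfree_hermite_basis (s : seq (weyl R)) :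
  uniq s -> [set` s] `<=` B -> lfree s.
Proof.
move=> s_uniq sB c c0.
have /choice[kt ktE] (i : 'I_(size s)) : exists kt : nat * nat,
    (1 <= kt.2)%N /\ s`_i = stein_hermite R kt.1 kt.2.
  have [k [t [t1 E]]] : B s`_i by apply: sB => /=; exact: mem_nth.
  by exists (k, t).
have coef_s (i : 'I_(size s)) k t : (1 <= t)%N ->
    (weyl_coef s`_i)`_t`_k = if (kt i).2 == t then (hermite R (kt i).1)`_k else 0.
  move=> t1; have [_ ->] := ktE i; rewrite /stein_hermite.
  rewrite -[weyl_coef _]/(weyl_coef (_ * _) - (_)%:P) weyl_coef_mulop_dxn.
  rewrite coefB coefZ coefXn coefC (gtn_eqF t1) subr0 eq_sym.
  by case: ifP; rewrite ?mulr1 // mulr0 coef0.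
move=> i0 lti0; apply: contraTeq isT => ci0.
have [i ci max_i] := @arg_maxnP _ (Ordinal lti0) (fun i => c i != 0)
  (fun i => (kt i).1) ci0.
case/eqP: ci; have [ti _] := ktE i; have [szH leadH] := size_lead_hermite (kt i).1.
have := congr1 (fun S => (weyl_coef S)`_(kt i).2`_(kt i).1) c0.
rewrite weyl_coef_sum !coef_sum (bigD1 i) //= big1 => [|j ji].
  by rewrite !coef0 addr0 coefZ mul_polyC coefZ coef_s // eqxx leadH mulr1.
rewrite coefZ mul_polyC coefZ coef_s //.
have [->|cj] := eqVneq (c j) 0; first by rewrite mul0r.
case: eqP => [tE|_]; last by rewrite mulr0.
have le_ji : ((kt j).1 <= (kt i).1)%N := max_i j cj.
(* Equal [t] and equal [k] would make the two entries of [s] equal, so [k] is strictly smaller for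
   [j] and its Hermite polynomial has too low a degree. *)
rewrite nth_default ?mulr0 // (size_lead_hermite _).1 ltn_neqAle le_ji andbT.
apply: contra_neqN ji => /eqP kE; apply/val_inj/eqP.
rewrite -(nth_uniq 0 (ltn_ord j) (ltn_ord i) s_uniq).
by have [_ ->] := ktE j; have [_ ->] := ktE i; rewrite kE tE.
Qed.

Lemma hermite_basis_is_basis : is_basis B [set S | gauss_adjoint S = 0].
Proof.
split; last exact: lfree_hermite_basis.
  by move=> _ [k [t [_ ->]]]; exact: gauss_adjoint_stein_hermite.
(* Subtracting the adjoint, which is 0, turns [S] into the sum of the differences
   [p_t d^t - creation^t p_t]; the one with [t = 0] vanishes. *)
move=> S /= S0; rewrite -[S]subr0 -[0](@mulop0 R) -S0 {1}[S]weyl_sumE mulop_sum -sumrB.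
apply: lspan_sum => -[[|t] ltt] _ /=; last exact: mulop_dxn_in_hermite_span.
by rewrite mulr1 subrr; exact: lspan0.
Qed.

End HermiteBasis.

(** * Bernstein dimension *)

Section BernsteinFiltration.
Variable R : realType.
Implicit Types (S T : weyl R) (p q : {poly {poly R}}).

(** Membership in the Bernstein filtration read off the coefficients: no monomial [x^j d^i] of total
    degree above [n] occurs. *)
Definition weight_le n p := forall i j, (n < i + j)%N -> p`_i`_j = 0.

Lemma weight_leS n p : weight_le n p -> weight_le n.+1 p.
Proof. by move=> p_n i j ltn; apply: p_n; exact: ltnW. Qed.

Lemma weight_le_dmul n p : weight_le n p -> weight_le n.+1 (dmul p).
Proof.
move=> p_n i j ltn; rewrite coef_dmul coefD coef_deriv p_n; last first.
  by rewrite addnS (ltn_trans (ltnSn _)) // (leq_trans ltn).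
case: i ltn => [|i] ltn; rewrite ?coef0 mul0rn add0r //.
by rewrite p_n // -ltnS -addSn.
Qed.

(** Left multiplication by [d] raises the total degree by at most one, since it either
    differentiates a coefficient or raises the order. *)
Lemma weight_leM m n p q : weight_le m p -> weight_le n q -> weight_le (m + n) (wmul p q).
Proof.
move=> p_m q_n i j ltmn; rewrite /wmul !coef_sum big1 // => k _.
rewrite coefZ coefM big1 // => l _.
have iter_n : weight_le (k + n) (iter k (@dmul R) q).
  by elim: (nat_of_ord k) => //= k' IH; rewrite addSn; exact: weight_le_dmul.
have [ltm|lem] := ltnP m (k + l); first by rewrite p_m // mul0r.
rewrite iter_n ?mulr0 //; have := ltn_ord l; lia.
Qed.

Lemma bernsteinP n S : bernstein n S <-> weight_le n (weyl_coef S).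
Proof.
split=> [|S_n].
  move: S; apply: lspan_min.
    split=> [i j _|c S T S_n T_n i j ltn]; first by rewrite !coef0.
    rewrite -[weyl_coef _]/(c%:P *: weyl_coef S + weyl_coef T) coefD coefZ coefD.
    by rewrite mul_polyC coefZ S_n // T_n // mulr0 addr0.
  move=> _ [a [b [le_ab ->]]] i j ltn.
  rewrite weyl_coef_mulop_dxn coefZ coefXn.
  have [ib|_] := eqVneq i b; last by rewrite mulr0 coef0.
  rewrite mulr1 coefXn; case: eqP => // ja; move: (leq_ltn_trans le_ab ltn).
  by rewrite ib ja addnC ltnn.
rewrite [S]weyl_sumE; apply: lspan_sum => t _.
rewrite -[(weyl_coef S)`_t]coefK poly_def mulop_sum mulr_suml.
apply: lspan_sum => a _; rewrite mulopZ -scalerAl.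
have [le_at|lt_at] := leqP (a + t) n.
  by apply/lspanZ/lspan_sub; exists a, t.
by rewrite S_n 1?addnC // scale0r; exact: lspan0.
Qed.

Lemma bernsteinM m n S T : bernstein m S -> bernstein n T -> bernstein (m + n) (S * T).
Proof. by move=> /bernsteinP Sm /bernsteinP Tn; apply/bernsteinP/weight_leM. Qed.

Lemma bernsteinS n S : bernstein n S -> bernstein n.+1 S.
Proof. by move=> /bernsteinP Sn; apply/bernsteinP/weight_leS. Qed.

Lemma bernstein_exhaust S : exists n, bernstein n S.
Proof.
exists (\max_(t < size (weyl_coef S)) (t + size ((weyl_coef S)`_t)%R))%N.
apply/bernsteinP => i j; have [lt_iS|?] := ltnP i (size (weyl_coef S)); last first.
  by rewrite [(weyl_coef S)`_i]nth_default // coef0.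
move=> lt_ij; rewrite nth_default // -(leq_add2l i) ltnW // (leq_ltn_trans _ lt_ij) //.
exact: (leq_bigmax (Ordinal lt_iS)).
Qed.

Lemma bernstein_mulop n (q : {poly R}) : (size q <= n.+1)%N -> bernstein n (mulop q).
Proof.
move=> le_qn; apply/bernsteinP => i j ltn; rewrite coefC; case: eqP => [i0|]; last first.
  by rewrite coef0.
by rewrite nth_default // (leq_trans le_qn) //; move: ltn; rewrite i0.
Qed.

Lemma bernstein0 n : bernstein n (0 : weyl R). Proof. exact: lspan0. Qed.

Lemma size_iter_creation (q : {poly R}) n :
  (size (iter n (@creation R) q) <= size q + n)%N.
Proof.
elim: n => [|n IHn]; rewrite ?addn0 // iterS addnS.
rewrite (leq_trans (size_polyD _ _)) // geq_max size_polyN.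
rewrite mulrC (leq_trans (size_polyMleq _ _)) ?size_polyX ?addn2 //=.
move: (iter n _ q) IHn => r IHn.
have [->|/lt_size_deriv/ltnW ler] := eqVneq r 0; first by rewrite deriv0 size_poly0.
by rewrite (leq_trans ler) // ltnW.
Qed.

(** Each [creation] adds at most one to the degree, so [x^a d^b] has an adjoint of degree at most
    [a + b]. This bounds the filtration of the quotient from above. *)
Lemma size_gauss_adjoint n S : bernstein n S -> (size (gauss_adjoint S) <= n.+1)%N.
Proof.
move: S; apply: lspan_min.
  split=> [|c S T Sn Tn] /=; first by rewrite gauss_adjoint0 size_poly0.
  rewrite gauss_adjointD gauss_adjointZ (leq_trans (size_polyD _ _)) //.
  by rewrite geq_max Tn (leq_trans (size_scale_leq _ _)).
move=> _ [a [b [le_ab ->]]]; rewrite /= gauss_adjoint_mulop_dxn.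
by rewrite (leq_trans (size_iter_creation _ _)) // size_polyXn addSn.
Qed.

End BernsteinFiltration.

(** * Comparison of filtrations and Hilbert polynomials *)

Section Hilbert.
Variables (R : realType) (M : lmodType (weyl R)^c).
Local Notation A := (weyl R).
Implicit Types (G W : nat -> set M) (v : M).

Lemma filtration0 G n : filtration G -> G n 0.
Proof. by case=> _ /(_ n) [k /has_dim0]. Qed.

Lemma filtration_sum G n I (r : seq I) (F : I -> M) : filtration G ->
  (forall i, G n (F i)) -> G n (\sum_(i <- r) F i).
Proof.
move=> fG GF; apply: big_ind => [|x y|//]; first exact: filtration0.
by case: fG => _ /(_ n) [k kG] _ _; exact: (has_dimD kG).
Qed.

Lemma filtration_mono G m n : filtration G -> (m <= n)%N -> G m `<=` G n.
Proof.
move=> [GS _ _ _] /subnK <-; elim: (n - m)%N => [|k IHk] // u /IHk.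
by rewrite addSn; exact: GS.
Qed.

(** A good filtration grows no faster, up to a shift, than any other one: a shift
    that captures the finitely many homogeneous components of the generators of
    the graded module works in all degrees. *)
Lemma good_filtration_shift G W : good_filtration G -> filtration W ->
  exists K, forall n, G n `<=` W (n + K)%N.
Proof.
move=> [fG [k [g [g_elt g_gen]]]] fW.
have /choice[N gN] (j : 'I_k) : exists N, forall n, (N <= n)%N -> g j n = 0.
  by have [_ [N gN]] := g_elt j; exists N.
have /choice[nu nuP] (ji : 'I_k * nat) : exists nu, W nu (g ji.1 ji.2).
  case: fW => _ _ WT _; have : (\bigcup_n W n) (g ji.1 ji.2) by rewrite WT.
  by case=> n _ ?; exists n.
(* [K] is a level of [W] containing all homogeneous components of the generators; beyond [N j] they
   are 0. *)
pose K := (\max_(j < k) \max_(i < N j) nu (j, nat_of_ord i))%N.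
have gK j i : W K (g j i).
  have [leN|ltN] := leqP (N j) i; first by rewrite gN //; exact: filtration0.
  apply: (filtration_mono fW _ (nuP (j, i))); rewrite /K.
  apply: leq_trans (leq_bigmax j).
  exact: (leq_bigmax (Ordinal ltN)).
exists K; elim=> [|n IHn] u Gu; last first.
  (* The family concentrated in degree [n + 1] with value [u] is expressed by the generators, up to
     an element of [G n] that the induction hypothesis covers. In degree 0 there is no such error
     term. *)
  have [|a [a_elt /(_ n.+1)]] := g_gen (fun m => if m == n.+1 then u else 0).
    split=> [m|]; first by case: eqP => [->//|_]; exact: filtration0.
    by exists n.+2 => m ltm; rewrite gtn_eqF.
  rewrite eqxx => /IHn Wu; rewrite -[u](subrK (\sum_(j < k) gr_act (g j) (a j) n.+1)).
  case: (fW) => WS /(_ (n.+1 + K)%N) [l Wl] _ WM; apply: (has_dimD Wl).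
    by rewrite addSn; exact: WS.
  apply: filtration_sum => // j; apply: filtration_sum => // i.
  have [a_j _] := a_elt j; apply: (filtration_mono fW _ (WM _ _ _ _ (gK j i) (a_j _))).
  by rewrite addnC leq_add2r leq_subr.
have [|a [a_elt /(_ 0%N)]] := g_gen (fun m => if m == 0%N then u else 0).
  split=> [m|]; first by case: eqP => [->//|_]; exact: filtration0.
  by exists 1%N => m ltm; rewrite gtn_eqF.
rewrite eqxx /= => /eqP; rewrite subr_eq0 => /eqP ->.
case: (fW) => _ _ _ WM.
apply: filtration_sum => // j; apply: filtration_sum => // i.
have [a_j _] := a_elt j; apply: (filtration_mono fW _ (WM _ _ _ _ (gK j i) (a_j _))).
by rewrite addnC leq_add2r leq_subr.
Qed.

Lemma large_nat n0 (x : R) : exists2 n, (n0 <= n)%N & x < n%:R.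
Proof.
exists (maxn n0 (Num.bound x)); first exact: leq_maxl.
by rewrite (lt_le_trans (unstable.ltr_bound x)) // ler_nat leq_maxr.
Qed.

(** If [p] had the larger degree, nonnegativity would make its leading coefficient positive. It
    would also be that of [p - q], which would then be positive at large integers. *)
Lemma size_poly_le_of_horner (p q : {poly R}) n0 :
  (forall n, (n0 <= n)%N -> 0 <= p.[n%:R] <= q.[n%:R]) -> (size p <= size q)%N.
Proof.
move=> pq; rewrite leqNgt; apply/negP => lt_qp.
have p_pos : 0 < lead_coef p.
  rewrite lt_neqAle eq_sym lead_coef_eq0 -size_poly_gt0 (leq_ltn_trans _ lt_qp) //=.
  rewrite leNgt; apply/negP => p_neg.
  have [|x xP] := @polyrcf.poly_pinfty_gt_lc _ (- p).
    by rewrite lead_coefN oppr_gt0.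
  have [n le_n0n ltxn] := large_nat n0 x.
  have /andP[p_ge0 _] := pq n le_n0n; have := xP n%:R (ltW ltxn).
  by rewrite lead_coefN hornerN; lra.
have [|x xP] := @polyrcf.poly_pinfty_gt_lc _ (p - q).
  by rewrite lead_coefDl ?size_polyN.
have [n le_n0n ltxn] := large_nat n0 x.
have /andP[_ p_le] := pq n le_n0n; have := xP n%:R (ltW ltxn).
by rewrite lead_coefDl ?size_polyN // hornerD hornerN; lra.
Qed.

Lemma hilbert_degree_le G W D D' : good_filtration G -> filtration W ->
  hilbert_degree G D -> hilbert_degree W D' -> (D <= D')%N.
Proof.
move=> goodG fW [p [<- [n0 pP]]] [q [<- [n1 qP]]].
have [K GW] := good_filtration_shift goodG fW.
rewrite -!subn1 leq_sub2r //.
(* The shift [K] is absorbed by composing [q] with [X + K], which keeps the degree. *)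
have <- : size (q \Po ('X + (K%:R)%:P)) = size q.
  by rewrite size_comp_poly2 // size_XaddC.
apply: (@size_poly_le_of_horner _ _ (maxn n0 n1)) => n.
rewrite geq_max => /andP[le_n0 le_n1].
have [k kG <-] := pP n le_n0.
have [l lW lE] := qP (n + K)%N (leq_trans le_n1 (leq_addr _ _)).
rewrite ler0n horner_comp !hornerE -natrD -lE ler_nat.
exact: (has_dim_le kG lW (GW n)).
Qed.

(** Two good filtrations dominate each other up to shifts, so their Hilbert polynomials have the
    same degree and [xget] has a unique choice. *)
Lemma bernstein_dimE G D : good_filtration G -> hilbert_degree G D ->
  bernstein_dim M = D.
Proof.
move=> goodG degG; apply: xget_unique; first by exists G.
move=> D' [W goodW degW]; apply/eqP; rewrite eqn_leq.
by rewrite (hilbert_degree_le goodW goodG.1 degW) // (hilbert_degree_le goodG goodW.1).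
Qed.

Definition cyclic_filtration v n : set M := [set (a : A^c) *: v | a in @bernstein R n].

Lemma cyclic_filtration_good v : (forall u, exists a : A^c, u = a *: v) ->
  (forall n, exists k, has_dim (cyclic_filtration v n : set (real_mod M)) k) ->
  good_filtration (cyclic_filtration v).
Proof.
move=> v_gen v_dim; split; first split=> //.
- by move=> n _ [a an <-]; exists a => //; exact: bernsteinS.
- apply/seteqP; split => // u _; have [a ->] := v_gen u.
  by have [n an] := bernstein_exhaust (a : A); exists n => //; exists a.
- move=> k n _ a [b bn <-] ak; exists ((b : A) * a); first exact: bernsteinM.
  by rewrite scalerA.
(* One homogeneous generator suffices: [v] placed in degree 0. *)
exists 1%N, (fun _ n => if n == 0%N then v else 0); split.
  move=> _; split; last by exists 1%N => -[].
  move=> n; case: eqP => [->|_]; last by exists 0; [exact: bernstein0|rewrite scale0r].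
  exists 1; last by rewrite scale1r.
  by rewrite -[1]/(mulop 1); apply: bernstein_mulop; rewrite size_poly1.
move=> u [u_elt [n0 u0]].
(* Demanding [a = 0] wherever [u n = 0] keeps the chosen family finitely supported. *)
have /choice[a aP] n : exists a : A,
    [/\ bernstein n a, u n = (a : A^c) *: v & u n = 0 -> a = 0].
  have [un0|un0] := pselect (u n = 0).
    by exists 0; split=> //; [exact: bernstein0|rewrite scale0r].
  by have [a an aE] := u_elt n; exists a; split=> // [|/un0 []]; rewrite aE.
exists (fun=> a); split.
  move=> _; split=> [n|]; first by have [] := aP n.
  by exists n0 => n /u0 un0; have [_ _] := aP n; apply.
move=> n; rewrite big_ord1 /gr_act big_ord_recl /= big1 ?addr0; last first.
  by move=> i _; rewrite scaler0.
rewrite subn0; have [_ <- _] := aP n; rewrite subrr; case: n => // n.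
by have [k /has_dim0] := v_dim n.
Qed.

End Hilbert.

(** * Dimensions of the filtration induced on a cyclic module *)

Section CyclicDimension.
Variables (R : realType) (M : lmodType (weyl R)^c) (v : M).
Local Notation A := (weyl R).

Lemma real_mod_sumZ (I : finType) (c : I -> R) (a : I -> A) :
  (\sum_i c i *: (((a i : A^c) *: v) : real_mod M) : real_mod M) =
  ((\sum_i c i *: a i : A) : A^c) *: v.
Proof.
rewrite scaler_suml; apply: eq_bigr => i _.
rewrite -[LHS]/(((c i)%:A : A^c) *: ((a i : A^c) *: v)) scalerA.
apply: (congr1 (fun b : A^c => b *: v)).
by rewrite -[LHS]/((a i : A) * (c i)%:A) -scalerAr mulr1.
Qed.

(** Reduces the dimension to finding operators in the Bernstein level [n] that are independent and
    spanning modulo the annihilator of [v]. *)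
Lemma has_dim_cyclic_filtration (I : finType) (a : I -> A) n :
  (forall i, bernstein n (a i)) ->
  (forall c : I -> R, ((\sum_i c i *: a i : A) : A^c) *: v = 0 -> forall i, c i = 0) ->
  (forall S, bernstein n S -> exists c : I -> R,
     (S : A^c) *: v = ((\sum_i c i *: a i : A) : A^c) *: v) ->
  has_dim (cyclic_filtration v n : set (real_mod M)) #|I|.
Proof.
move=> a_n a_free a_span.
apply: (@has_dim_fin _ _ _ (fun i => ((a i : A^c) *: v) : real_mod M)).
  by move=> c; rewrite (real_mod_sumZ c a) => c0; exact: (a_free c c0).
apply/seteqP; split=> [_ [S Sn <-]|_ [c _ <-]].
  by have [c ->] := a_span S Sn; exists c => //; rewrite real_mod_sumZ.
rewrite real_mod_sumZ; exists (\sum_i c i *: a i) => //.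
by apply: lspan_sum => i _; exact/lspanZ/a_n.
Qed.

(** Here the action on [v] is injective, so the dimension is the number of monomials of total degree
    at most [n]. They are indexed by the total degree [i] and then the order [b <= i]. *)
Lemma has_dim_free_cyclic n : (forall S, (S : A^c) *: v = 0 -> S = 0) ->
  has_dim (cyclic_filtration v n : set (real_mod M)) (\sum_(i < n.+1) i.+1).
Proof.
move=> v_free; pose I := {i : 'I_n.+1 & 'I_i.+1}.
have <- : #|{: I}| = (\sum_(i < n.+1) i.+1)%N.
  rewrite card_tagged sumnE big_map big_enum /=.
  by apply: eq_bigr => i _; rewrite card_ord.
pose a (x : I) : A := mulop 'X^(tag x - tagged x) * dx R ^+ tagged x.
apply: (@has_dim_cyclic_filtration _ a) => [[i b]|c /v_free c0 x|].
- rewrite /a /=; apply: lspan_sub; exists (i - b)%N, (b : nat).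
  by rewrite subnK ?leq_ord // -ltnS.
- have coef_a y i j :
      (weyl_coef (a y))`_i`_j = (tagged y == i :> nat)%:R * (tag y - tagged y == j)%N%:R.
    rewrite /a weyl_coef_mulop_dxn coefZ coefXn eq_sym.
    by case: eqP => _; rewrite ?mulr1 ?mulr0 ?coef0 ?mul0r // mul1r coefXn eq_sym.
  have := congr1 (fun S => (weyl_coef S)`_(tagged x)`_(tag x - tagged x)) c0.
  rewrite weyl_coef_sum !coef_sum (bigD1 x) // big1 => [|y yx].
    by rewrite coef_weyl_scale coef_a !eqxx !mulr1 !coef0 /= addr0.
  rewrite coef_weyl_scale coef_a.
  case: eqP => [bE|_]; last by rewrite mul0r mulr0.
  case: eqP => [dE|_]; last by rewrite !mulr0.
  case/eqP: yx; case: x y bE dE => [i b] [i' b'] /= bE dE.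
  have iE : i = i' by apply: val_inj => /=; have := ltn_ord b; have := ltn_ord b'; lia.
  by case: _ / iE b' bE {dE} => b' bE; congr (existT _ _ _); apply: val_inj.
move=> S Sn; suff [c ->] : exists c : I -> R, S = \sum_i c i *: a i by exists c.
move: S Sn; apply: lspan_min.
  split=> [|r _ _ [c ->] [d ->]].
    by exists (fun=> 0); rewrite big1 // => i _; rewrite scale0r.
  exists (fun i => r * c i + d i); rewrite scaler_sumr -big_split /=.
  by apply: eq_bigr => i _; rewrite scalerDl scalerA.
move=> _ [p [b [le_pb ->]]].
have lt_b : (b < (Ordinal (le_pb : p + b < n.+1)%N).+1)%N by rewrite /= ltnS leq_addl.
exists (fun x => (x == existT _ (Ordinal (le_pb : p + b < n.+1)%N) (Ordinal lt_b))%:R).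
rewrite (bigD1 (existT _ (Ordinal (le_pb : p + b < n.+1)%N) (Ordinal lt_b))) //=.
rewrite eqxx scale1r big1 ?addr0 => [|x /negPf ->]; last by rewrite scale0r.
by rewrite /a /= addnK.
Qed.

(** The powers [x^i] with [i <= n] act independently on [v] because multiplication by [q] has
    adjoint [q]; they span because [S] acts on [v] like multiplication by its adjoint. *)
Lemma has_dim_gauss_cyclic n :
  (forall S, (S : A^c) *: v = 0 <-> gauss_adjoint S = 0) ->
  has_dim (cyclic_filtration v n : set (real_mod M)) n.+1.
Proof.
move=> vE; rewrite -[n.+1]card_ord.
apply: (@has_dim_cyclic_filtration _ (fun i : 'I_n.+1 => mulop 'X^i)).
- by move=> i; apply: bernstein_mulop; rewrite size_polyXn.
- move=> c /vE; under eq_bigr do rewrite -mulopZ.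
  rewrite -mulop_sum gauss_adjoint_mulop => c0 i.
  have := congr1 (fun q : {poly R} => q`_i) c0.
  rewrite coef0 coef_sum (bigD1 i) //= big1 => [|j /negPf ji].
    by rewrite addr0 coefZ coefXn eqxx mulr1.
  by rewrite coefZ coefXn eq_sym -[(_ == _)%N]/(j == i) ji mulr0.
move=> S Sn; exists (fun i : 'I_n.+1 => (gauss_adjoint S)`_i).
under eq_bigr do rewrite -mulopZ.
rewrite -mulop_sum -(poly_def _ (fun i => (gauss_adjoint S)`_i)).
rewrite (_ : \poly_(_ < _) _ = gauss_adjoint S); last first.
  apply/polyP => i; rewrite coef_poly; case: ltnP => // lt_ni.
  by rewrite nth_default // (leq_trans (size_gauss_adjoint Sn)).
apply/eqP; rewrite -subr_eq0 -scalerBl; apply/eqP/vE.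
by rewrite gauss_adjointB gauss_adjoint_mulop subrr.
Qed.

End CyclicDimension.

(** * The ideal of [d - x] and its quotient as right modules *)

Section SteinIdeal.
Variable R : realType.
Local Notation A := (weyl R).
Local Notation K := (right_multiples (stein_op R)).
Variable hK : right_ideal K.

(** The generator is [d - x] itself; left multiplication by it is injective, so the ideal is free of
    rank one. *)
Lemma ideal_mod_generator : exists v : ideal_mod hK,
  (forall u, exists a : A^c, u = a *: v) /\
  (forall S : A, (S : A^c) *: v = 0 -> S = 0).
Proof.
have K1 : K (stein_op R) by exists 1; rewrite ?mulr1.
exists (exist _ (stein_op R) (mem_set K1)); split=> [u|S].
  by have [a _ aE] := set_mem (valP u); exists a; apply: val_inj; rewrite /= -aE.
move/(congr1 val) => /= S0; apply: (@stein_op_inj R); rewrite mulr0.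
exact: S0.
Qed.

(** The generator is the class of 1, whose annihilator is the ideal. *)
Lemma ideal_quot_generator : exists v : ideal_quot hK,
  (forall u, exists a : A^c, u = a *: v) /\
  (forall S : A, (S : A^c) *: v = 0 <-> gauss_adjoint S = 0).
Proof.
pose U := right_ideal_submodule hK.
pose pi (S : A) : ideal_quot hK := (\pi_(Quotient.quot (submod_zmodClosed U)) S)%qT.
pose v := pi 1; have vE (S : A) : (S : A^c) *: v = pi S.
  rewrite -[LHS]/(quotmod_scale _ _) quotmod_scaleE; congr (\pi%qT _).
  by rewrite -[LHS]/((1 : A) * S) mul1r.
exists v; split=> [u|S].
  by have [S ->] := quotmod_piP u; exists S; rewrite vE.
rewrite vE; have := right_multiples_stein_op R => /seteqP[KE EK].
rewrite (_ : 0 = pi 0).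
  split=> [/eqP|S0]; first by rewrite -Quotient.idealrBE subr0 => /set_mem/KE.
  by apply/eqP; rewrite -Quotient.idealrBE subr0; exact/mem_set/EK.
by rewrite -[RHS]vE scale0r.
Qed.

Lemma sum_ord_succ n : (\sum_(i < n.+1) i.+1)%:R = (n%:R + 1) * (n%:R + 2) / 2 :> R.
Proof.
elim: n => [|n IHn]; first by rewrite big_ord1 /=; lra.
by rewrite big_ord_recr /= natrD IHn -!natr1; field.
Qed.

Lemma bernstein_dim_ideal_mod : bernstein_dim (ideal_mod hK) = 2%N.
Proof.
have [v [v_gen v_free]] := ideal_mod_generator.
have v_dim n := has_dim_free_cyclic n v_free.
apply: (@bernstein_dimE _ _ (cyclic_filtration v)).
  by apply: cyclic_filtration_good => // n; exists (\sum_(i < n.+1) i.+1)%N.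
exists (2^-1 *: (('X + 1%:P) * ('X + 2%:P))); split.
  rewrite size_scale ?invr_eq0 ?pnatr_eq0 // size_mul ?size_XaddC //;
    by rewrite -size_poly_eq0 size_XaddC.
exists 0%N => n _; exists (\sum_(i < n.+1) i.+1)%N => //.
by rewrite sum_ord_succ hornerZ hornerM 2!hornerD hornerX 2!hornerC; field.
Qed.

Lemma bernstein_dim_ideal_quot : bernstein_dim (ideal_quot hK) = 1%N.
Proof.
have [v [v_gen vE]] := ideal_quot_generator.
have v_dim n := has_dim_gauss_cyclic n vE.
apply: (@bernstein_dimE _ _ (cyclic_filtration v)).
  by apply: cyclic_filtration_good => // n; exists n.+1.
exists ('X + 1%:P); split; first by rewrite size_XaddC.
by exists 0%N => n _; exists n.+1 => //; rewrite !hornerE natr1.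
Qed.

Lemma fin_gen_ideal_quot : fin_gen (ideal_quot hK).
Proof.
have [v [v_gen _]] := ideal_quot_generator.
exists [:: v]; apply/seteqP; split => // u _; have [a ->] := v_gen u.
by apply/lspanZ/lspan_sub; rewrite /= inE.
Qed.

Lemma cyclic_ideal_mod : cyclic_module (ideal_mod hK).
Proof. by have [v [v_gen _]] := ideal_mod_generator; exists v. Qed.

End SteinIdeal.

(** * Gaussian integration by parts *)

Section WholeLine.
Variable R : realType.
Local Notation mu := (@lebesgue_measure R).

Lemma derivable_continuous_line (u u' : R -> R) :
  (forall x : R, is_derive x (1 : R) u (u' x)) -> continuous u.
Proof.
move=> du x; apply: differentiable_continuous; apply/derivable1_diffP.
exact: (@ex_derive _ _ _ _ _ _ _ (du x)).
Qed.

Lemma integral_itv_derivative (u u' : R -> R) a b : a < b ->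
  (forall x : R, is_derive x (1 : R) u (u' x)) -> continuous u' ->
  (\int[mu]_(x in `[a, b]) (u' x)%:E = (u b)%:E - (u a)%:E)%E.
Proof.
move=> ab du cu'; have cu := derivable_continuous_line du.
apply: continuous_FTC2 => //.
- exact: continuous_subspaceT.
- split; first by move=> x _; exact: (@ex_derive _ _ _ _ _ _ _ (du x)).
  + exact/cvg_at_right_filter/cu.
  + exact/cvg_at_left_filter/cu.
- by move=> x _; rewrite derive1E (@derive_val _ _ _ _ _ _ _ (du x)).
Qed.

(** The cutoff [1 - x ^ 2 / n ^ 2] vanishes at [n] and [-n], so that multiplying
    by it kills the boundary terms, whatever [u] does at infinity; it tends to [1]
    and its derivative to [0], both boundedly on [[-n, n]]. *)
Lemma integral_line_derivative (u u' : R -> R) :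
  (forall x : R, is_derive x (1 : R) u (u' x)) -> continuous u' ->
  mu.-integrable setT (EFin \o u) -> mu.-integrable setT (EFin \o u') ->
  (\int[mu]_x (u' x)%:E = 0)%E.
Proof.
move=> du cu' iu iu'; have cu := derivable_continuous_line du.
pose h n : R := n.+1%:R^-1.
have h_gt0 n : 0 < h n by rewrite invr_gt0.
have h_le1 n : h n <= 1 by rewrite invf_le1 // ler1n.
have hN n : h n * n.+1%:R = 1 by rewrite mulVf.
pose chi n : {poly R} := 1%:P - (h n ^+ 2)%:P * 'X^2.
have chiE n x : (chi n).[x] = 1 - h n ^+ 2 * x ^+ 2.
  by rewrite /chi !(hornerD, hornerN, hornerCM, hornerXn) hornerC.
have chi'E n x : (chi n)^`().[x] = - (2 * h n ^+ 2 * x).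
  rewrite /chi derivB derivM !derivC derivXn mul0r !add0r /=.
  by rewrite hornerN hornerCM hornerMn hornerX -mulr_natl; ring.
pose w' n (x : R) := u x * (chi n)^`().[x] + (chi n).[x] * u' x.
have dw n (x : R) : is_derive x (1 : R) (u * horner (chi n)) (w' n x).
  exact: (is_deriveM (du x) (is_derive_poly (chi n) x)).
have cw' n : continuous (w' n).
  move=> x; apply: cvgD; apply: cvgM; [exact: cu|exact: continuous_horner|
    exact: continuous_horner|exact: cu'].
have w'0 n : (\int[mu]_(x in `[(- n.+1%:R)%R, n.+1%:R%R]) (w' n x)%:E = 0)%E.
  rewrite (integral_itv_derivative _ (dw n) (cw' n)); last first.
    by rewrite (@lt_trans _ _ 0) // oppr_lt0.
  have chi0 : (chi n).[n.+1%:R] = 0 by rewrite chiE -exprMn hN expr1n subrr.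
  have chi0' : (chi n).[- n.+1%:R] = 0 by rewrite chiE sqrrN -exprMn hN expr1n subrr.
  by rewrite !fctE chi0 chi0' !mulr0 sube0.
pose f n (x : R) : R := (w' n \_ `[- n.+1%:R, n.+1%:R]) x.
have fE n (x : R) : `|x| <= n.+1%:R -> f n x = w' n x.
  by rewrite ler_norml /f patchE => xn; rewrite mem_set //= in_itv.
have f0 n (x : R) : ~ (`|x| <= n.+1%:R) -> f n x = 0.
  move=> xn; rewrite /f patchE memNset //= in_itv /= -ler_norml.
  exact: xn.
have mf n : measurable_fun [set: measurableTypeR R] (EFin \o f n).
  apply/measurable_EFinP; apply/(measurable_restrictT _ _).1 => //.
  by apply/measurable_funTS; apply: continuous_measurable_fun; exact: cw'.
have f_int n : (\int[mu]_x (f n x)%:E = 0)%E.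
  by rewrite -[RHS](w'0 n) [RHS]integral_mkcond restrict_EFin.
(* For fixed [x] the truncation is eventually inactive, and the limit comes from replacing [h n] by
   0. *)
have f_cvg (x : R) : f n x @[n --> \oo] --> u' x.
  have h_cvg : h n @[n --> \oo] --> (0 : R) by exact: cvg_harmonic.
  have : w' n x @[n --> \oo] --> u x * - (2 * 0 ^+ 2 * x) + (1 - 0 ^+ 2 * x ^+ 2) * u' x.
    rewrite /w'; under eq_fun do rewrite chiE chi'E.
    apply: cvgD; apply: cvgM; try exact: cvg_cst.
      apply: cvgN; apply: cvgM; last exact: cvg_cst.
      by apply: cvgM; [exact: cvg_cst|exact: cvgM].
    by apply: cvgB; [exact: cvg_cst|apply: cvgM; [exact: cvgM|exact: cvg_cst]].
  rewrite expr0n /= mulr0 !mul0r oppr0 mulr0 add0r addr0 mul1r.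
  apply: cvg_trans; apply: near_eq_cvg; near=> n.
  apply/esym/fE/ltW/(lt_le_trans (unstable.ltr_norm_bound x)).
  by rewrite ler_nat leqW //; near: n; exact: nbhs_infty_ge.
(* On the interval, [h n * |x| <= 1] gives [|chi| <= 1] and, with [h n <= 1], [|chi'| <= 2]. *)
have f_dom n (x : R) : (`|(f n x)%:E| <= (`|u' x| + 2 * `|u x|)%:E)%E.
  rewrite lee_fin; have [/[dup] xn /fE ->|/negP/f0 ->] := boolP (`|x| <= n.+1%:R);
    last first.
    by rewrite normr0 addr_ge0 ?mulr_ge0.
  rewrite /w' (le_trans (ler_normD _ _)) // addrC !normrM lerD //.
    rewrite ler_piMl // chiE.
    have hx : h n ^+ 2 * x ^+ 2 <= 1.
      rewrite -exprMn -real_normK ?num_real // expr_le1 // normrM gtr0_norm //.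
      by rewrite -(hN n) ler_pM2l.
    have : 0 <= h n ^+ 2 * x ^+ 2 by rewrite mulr_ge0 ?sqr_ge0.
    by rewrite ler_norml; lra.
  rewrite mulrC ler_wpM2r // chi'E normrN 2!normrM normr_nat (ger0_norm (sqr_ge0 _)).
  have hx : h n * `|x| <= 1 by rewrite -(hN n) ler_pM2l.
  rewrite -mulrA ger_pMr // expr2 -mulrA; apply: mulr_ile1 => //; first exact: ltW.
  exact: mulr_ge0 (ltW (h_gt0 n)) (normr_ge0 x).
have i_dom : mu.-integrable setT (fun x => (`|u' x| + 2 * `|u x|)%:E).
  have := integrableD measurableT (integrable_abse iu')
    (integrableZl measurableT 2 (integrable_abse iu)).
  by apply: eq_integrable.
have [| |_ _] := @dominated_convergence _ _ _ mu setT measurableT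
  (fun n => EFin \o f n) (EFin \o u') _ mf (measurable_int _ iu') _ i_dom _.
- apply: aeW => x _; apply: cvg_EFin; last exact: f_cvg.
  by apply: nearW.
- by apply: aeW => x n _; exact: f_dom.
under [X in X @ _ --> _]eq_fun do rewrite f_int.
by move/cvg_lim => <- //; rewrite lim_cst.
Unshelve. all: by end_near. Qed.

End WholeLine.

(** * Expectations under the standard normal law *)

Section NormalLaw.
Variable R : realType.
Local Notation mu := (@lebesgue_measure R).
Local Notation phi := (@normal_pdf R 0 1).

(** The Radon-Nikodym derivative of the normal law agrees almost everywhere with [normal_pdf], as
    both have the same integrals over measurable sets. *)
Lemma ge0_integral_normal_prob (m s : R) (f : R -> \bar R) :
  measurable_fun setT f -> (forall x, 0 <= f x)%E ->
  (\int[normal_prob m s]_x f x = \int[mu]_x (f x * (normal_pdf m s x)%:E))%E.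
Proof.
move=> mf f0; have dom := normal_prob_dominates m s.
rewrite -(Radon_Nikodym_SigmaFinite.change_of_variables dom) //.
have i_dens := Radon_Nikodym_SigmaFinite.f_integrable dom.
have m_pdf : measurable_fun setT (fun x => (normal_pdf m s x)%:E).
  by apply/measurable_EFinP; exact: measurable_normal_pdf.
apply: ae_eq_integral => //.
- exact: emeasurable_funM (measurable_int _ i_dens).
- exact: emeasurable_funM.
apply: ae_eqe_mul2l; apply: integral_ae_eq => // E _ mE.
by rewrite -Radon_Nikodym_SigmaFinite.f_integral.
Qed.

Lemma is_derive_normal_pdf (x : R) : is_derive x (1 : R) phi (- x * phi x).
Proof.
rewrite normal_pdfE ?oner_eq0 //.
have -> : normal_fun 0 1 = expR \o horner (- (2^-1 *: 'X^2)) :> (R -> R).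
  apply/funext => y; rewrite /normal_fun /= subr0 expr1n hornerN hornerZ hornerXn.
  by rewrite mulNr mulrC.
rewrite [X in is_derive _ _ X](_ : _ =
  (fun=> normal_peak 1) * (expR \o horner (- (2^-1 *: 'X^2)))); last by apply/funext.
apply: is_derive_eq.
rewrite scaler0 addr0 derivN derivZ derivXn !hornerN !hornerZ hornerMn hornerX.
rewrite /GRing.scale /=.
by rewrite hornerN hornerZ /=; field.
Qed.

Section Gaussian.
Context d (T : measurableType d) (P : probability T R) (N : {RV P >-> R}).
Hypothesis hN : forall B : set R, measurable B ->
  distribution P N B = normal_prob 0 1 B.
Implicit Types f g : R -> R.

Lemma ge0_integral_gauss (f : R -> \bar R) :
  measurable_fun setT f -> (forall x, 0 <= f x)%E ->
  (\int[P]_w f (N w) = \int[mu]_x (f x * (phi x)%:E))%E.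
Proof.
move=> mf f0; rewrite -(ge0_integral_normal_prob 0 1 mf f0).
(* [distribution P N] and [normal_prob] are measures on copies of [R] with different
   displays, so the law is taken again with values in [measurableTypeR R]. *)
have mN : measurable_fun setT (N : T -> measurableTypeR R).
  by move=> mT B mB; exact: (measurable_funPT N mT).
rewrite -[LHS](@ge0_integral_pushforward _ _ _ (measurableTypeR R) R N mN P setT f) //.
apply: (@eq_measure_integral _ _ _ _ (normal_prob 0 1)
  (measure_function_pushforward__canonical__measure_function_Measure P mN)) => A mA _.
exact: hN.
Qed.

Lemma integrable_gauss f : measurable_fun setT f ->
  P.-integrable setT (fun w => (f (N w))%:E) <->
  mu.-integrable setT (fun x => (f x * phi x)%:E).
Proof.
move=> mf; have mEf : measurable_fun setT (EFin \o f) by exact/measurable_EFinP.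
have E : (\int[P]_w `|(f (N w))%:E| = \int[mu]_x `|(f x * phi x)%:E|)%E.
  rewrite (@ge0_integral_gauss (fun x => `|(f x)%:E|%E)) //; last exact: measurableT_comp.
  apply: eq_integral => x _.
  have phi0 : (0 <= (phi x)%:E)%E by rewrite lee_fin normal_pdf_ge0.
  by rewrite EFinM abseM (gee0_abs phi0).
split=> /integrableP[_ fin]; apply/integrableP; split.
- apply/measurable_EFinP; apply: measurable_funM => //; exact: measurable_normal_pdf.
- by rewrite -E.
- apply/measurable_EFinP; exact: measurableT_comp.
- by rewrite E.
Qed.

Lemma integral_gauss f : measurable_fun setT f ->
  (\int[P]_w (f (N w))%:E = \int[mu]_x (f x * phi x)%:E)%E.
Proof.
move=> mf; have mEf : measurable_fun setT (EFin \o f) by exact/measurable_EFinP.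
have phi0 x : (0 <= (phi x)%:E)%E by rewrite lee_fin normal_pdf_ge0.
rewrite [LHS]integralE [RHS]integralE; congr (_ - _)%E.
  transitivity (\int[P]_w ((EFin \o f)^\+ (N w)))%E.
    by apply: eq_integral => w _; rewrite !funeposE.
  rewrite ge0_integral_gauss //; last exact: measurable_funepos.
  by apply: eq_integral => x _; rewrite !funeposE EFinM maxe_pMl ?mul0e.
transitivity (\int[P]_w ((EFin \o f)^\- (N w)))%E.
  by apply: eq_integral => w _; rewrite !funenegE.
rewrite ge0_integral_gauss //; last exact: measurable_funeneg.
by apply: eq_integral => x _; rewrite !funenegE EFinM maxe_pMl ?mul0e ?mulNe.
Qed.

(** The integrand times [phi] is the derivative of [g phi], because [phi' = - x phi], so its
    integral over the line vanishes. *)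
Lemma stein_identity g g' :
  (forall x : R, is_derive x (1 : R) g (g' x)) -> continuous g' ->
  P.-integrable setT (fun w => (g (N w))%:E) ->
  P.-integrable setT (fun w => (g' (N w) - N w * g (N w))%:E) ->
  (\int[P]_w (g' (N w) - N w * g (N w))%:E = 0)%E.
Proof.
move=> dg cg' ig iSg; have cg := derivable_continuous_line dg.
pose Sg x := g' x - x * g x.
have cSg : continuous Sg.
  by move=> x; apply: cvgB; [exact: cg'|apply: cvgM; [exact: cvg_id|exact: cg]].
have mg : measurable_fun setT g by exact: continuous_measurable_fun.
have mSg : measurable_fun setT Sg by exact: continuous_measurable_fun.
rewrite (integral_gauss mSg); apply: (@integral_line_derivative _ (g * phi)).
- move=> x; apply: (is_derive_eq (is_deriveM (dg x) (is_derive_normal_pdf x))).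
  by rewrite /Sg /GRing.scale /=; ring.
- move=> x; apply: cvgM; first exact: cSg.
  exact: (@continuous_normal_pdf _ 0 1 (oner_neq0 R)).
- exact/(integrable_gauss mg).
- exact/(integrable_gauss mSg).
Qed.

End Gaussian.

End NormalLaw.

(** * Stein operators *)

Section OperatorAction.
Variable R : realType.
Implicit Types (S L : weyl R) (f : R -> R).

Lemma weyl_actE n S f x : (size (weyl_coef S) <= n)%N ->
  weyl_act S f x = \sum_(t < n) ((weyl_coef S)`_t).[x] * derive1n t f x.
Proof.
move=> le_Sn; rewrite /weyl_act.
rewrite (big_ord_widen _ (fun t => ((weyl_coef S)`_t).[x] * derive1n t f x) le_Sn).
rewrite big_mkcond /=; apply: eq_bigr => i _; case: ltnP => // le_Si.
by rewrite nth_default // horner0 mul0r.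
Qed.

Lemma weyl_actB S L f x : weyl_act (S - L) f x = weyl_act S f x - weyl_act L f x.
Proof.
set n := maxn (size (weyl_coef S)) (size (weyl_coef L)).
rewrite (@weyl_actE n S) ?leq_maxl // (@weyl_actE n L) ?leq_maxr //.
rewrite (@weyl_actE n); last first.
  by rewrite (leq_trans (size_polyD _ _)) // size_polyN.
rewrite -sumrB; apply: eq_bigr => i _.
by rewrite -mulrBl -hornerN -hornerD -coefN -coefD.
Qed.

Lemma weyl_act_mulop (q : {poly R}) f x : weyl_act (mulop q) f x = q.[x] * f x.
Proof. by rewrite (@weyl_actE 1) ?size_polyC_leq1 // big_ord1 coefC. Qed.

Lemma Ck_is_derive k f t (x : R) : Ck k f -> (t < k)%N ->
  is_derive x (1 : R) (derive1n t f) (derive1n t.+1 f x).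
Proof.
move=> [df _] ltk; apply: DeriveDef; first exact: df.
by rewrite derive1nS derive1E.
Qed.

Lemma Ck_continuous k f t : Ck k f -> (t <= k)%N -> continuous (derive1n t f).
Proof.
move=> fk; rewrite leq_eqVlt => /predU1P[->|ltk]; first by case: fk.
by apply: derivable_continuous_line => x; exact: Ck_is_derive fk ltk.
Qed.

Lemma weyl_act_is_derive k L f (x : R) : Ck k f -> (size (weyl_coef L) <= k)%N ->
  is_derive x (1 : R) (weyl_act L f) (weyl_act (dx R * L) f x).
Proof.
move=> fk le_Lk.
have -> : weyl_act L f =
    \sum_(t < k) (horner (weyl_coef L)`_t * derive1n t f).
  by apply/funext => y; rewrite (weyl_actE _ _ le_Lk) fct_sumE.
have -> : weyl_act (dx R * L) f x = \sum_(t < k)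
    (((weyl_coef L)`_t).[x] *: derive1n t.+1 f x +
     derive1n t f x *: ((weyl_coef L)`_t)^`().[x]).
  rewrite (weyl_actE _ _ (size_weyl_coef_dx le_Lk)).
  rewrite weyl_coef_dx.
  under eq_bigr => t _ do rewrite coef_dmul hornerD mulrDl.
  (* The sum with [p_t'] loses its top term since [p_k = 0], and the shifted sum its bottom term;
     both then run over [t < k]. *)
  rewrite big_split big_ord_recr /= [(weyl_coef L)`_k]nth_default //.
  rewrite deriv0 horner0 mul0r addr0 [X in _ + X]big_ord_recl /= horner0 mul0r add0r.
  rewrite -big_split /=; apply: eq_bigr => t _.
  by rewrite addrC; congr (_ + _); rewrite /GRing.scale /= mulrC.
apply: is_derive_sum => t.
exact: is_deriveM (is_derive_poly _ _) (Ck_is_derive _ fk _).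
Qed.

Lemma weyl_act_stein_op L f x :
  weyl_act (stein_op R * L) f x = weyl_act (dx R * L) f x - x * weyl_act L f x.
Proof.
rewrite mulrBl weyl_actB; congr (_ - _).
rewrite (@weyl_actE (size (weyl_coef L))) weyl_coef_mulop ?size_scale_leq //.
rewrite mulr_sumr; apply: eq_bigr => t _.
by rewrite coefZ hornerM hornerX mulrA.
Qed.

Lemma continuous_weyl_act k S f : Ck k f -> (size (weyl_coef S) <= k.+1)%N ->
  continuous (weyl_act S f).
Proof.
move=> fk le_Sk; have -> : weyl_act S f =
    \sum_(t < k.+1) (horner (weyl_coef S)`_t * derive1n t f).
  by apply/funext => y; rewrite (weyl_actE _ _ le_Sk) fct_sumE.
elim/big_ind: _ => [x|u v cu cv x|t _ x].
- exact: cvg_cst.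
- by apply: cvgD; [exact: cu|exact: cv].
- apply: cvgM; first exact: continuous_horner.
  by apply: (Ck_continuous fk); rewrite -ltnS.
Qed.

(** The coefficients of [L] are recovered from those of [(d - x) L] without raising
    degrees, so [L f] is controlled by the same moments as [(d - x) L f]. *)
Lemma size_coef_stein_op m L :
  (forall t, (size ((weyl_coef (stein_op R * L))`_t)%R <= m.+1)%N) ->
  forall t, (size ((weyl_coef L)`_t)%R <= m.+1)%N.
Proof.
move=> szS; have size_creation (q : {poly R}) : q != 0 -> size (creation q) = (size q).+1.
  move=> q0; rewrite /creation mulrC size_polyDl size_mulX // size_polyN.
  by rewrite ltnW // ltnS lt_size_deriv.
(* As [creation] raises degrees by exactly one, a bound on [r - creation q] and [r] passes to [q].
   It is applied to consecutive coefficients of [L], by induction on the order. *)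
have step (q r : {poly R}) : (size (r - creation q)%R <= m.+1)%N -> (size r <= m.+1)%N ->
    (size q <= m.+1)%N.
  have [->|q0] := eqVneq q 0; first by rewrite size_poly0.
  move=> szrq szr; rewrite ltnW // -size_creation // -[creation q](subKr r).
  by rewrite (leq_trans (size_polyD _ _)) // geq_max size_polyN szr.
elim=> [|t IHt].
  apply: (step _ 0); last by rewrite size_poly0.
  have := szS 0%N; rewrite weyl_coef_stein_op coefB coefZ coef_dmul addr0.
  by rewrite sub0r /creation opprB.
apply: step IHt; have := szS t.+1; rewrite weyl_coef_stein_op coefB coefZ coef_dmul.
by rewrite /creation opprB addrA [_ + _^`()]addrC.
Qed.

End OperatorAction.

(** * Gaussian estimates and null sets *)

Section GaussianBounds.
Variable R : realType.
Local Notation mu := (@lebesgue_measure R).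
Local Notation phi := (@normal_pdf R 0 1).

(** A single term [y^(n+1) / (n+1)!] of the exponential series at [y = c x^2] dominates for
    [|x| > 1]; the summand 1 in the constant covers [|x| <= 1]. *)
Lemma exprn_le_expR_sqr (c : R) n : 0 < c ->
  exists C, forall x, `|x| ^+ n <= C * expR (c * x ^+ 2).
Proof.
move=> c0; pose f : R := n.+1`!%:R / c ^+ n.+1; exists (1 + f) => x.
have f_ge0 : 0 <= f by rewrite divr_ge0 // exprn_ge0 ?ltW.
set y := c * x ^+ 2.
have y_ge0 : 0 <= y by exact: mulr_ge0 (ltW c0) (sqr_ge0 x).
have fact0 : 0 < n.+1`!%:R :> R by rewrite ltr0n fact_gt0.
have /= exp_y := expR_ge1Dxn n y_ge0.
have y_le : (x ^+ 2) ^+ n.+1 <= f * expR y.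
  have -> : (x ^+ 2) ^+ n.+1 = f * (y ^+ n.+1 / n.+1`!%:R).
    have c_neq0 : c ^+ n.+1 != 0 by rewrite expf_neq0 ?gt_eqF.
    have cancel (z e F : R) : e != 0 -> 0 < F -> z = F / e * (e * z / F).
      by move=> e0 F0; field; rewrite e0 gt_eqF.
    by rewrite /y (exprMn _ c); exact: cancel.
  by rewrite ler_wpM2l // (le_trans _ exp_y) // lerDr.
have exp_ge1 : 1 <= expR y by rewrite (le_trans _ exp_y) // lerDl divr_ge0 ?exprn_ge0.
have xn_le : `|x| ^+ n <= 1 + (x ^+ 2) ^+ n.+1.
  have [x_le1|x_gt1] := leP `|x| 1.
    apply: (@le_trans _ _ 1); first exact: exprn_ile1.
    by rewrite lerDl exprn_ge0 ?sqr_ge0.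
  apply: (@le_trans _ _ (`|x| ^+ (2 * n.+1))).
    by apply: ler_weXn2l; [exact: ltW|lia].
  by rewrite exprM real_normK ?num_real // lerDr.
by rewrite (le_trans xn_le) // mulrDl mul1r lerD.
Qed.

Lemma normal_pdf01E x : phi x = normal_peak 1 * expR (- (x ^+ 2 / 2)).
Proof. by rewrite normal_pdfE ?oner_eq0 // /normal_fun subr0 expr1n mulNr. Qed.

Lemma normal_pdf01_gt0 x : 0 < phi x.
Proof. by rewrite normal_pdf01E mulr_gt0 ?expR_gt0 // normal_peak_gt0 ?oner_eq0. Qed.

Lemma poly_gauss_bounded (p : {poly R}) : exists C, forall x, `|p.[x] * phi x| <= C.
Proof.
have half0 : 0 < 2^-1 :> R by rewrite invr_gt0.
have /choice[C CP] n : exists C, forall x, `|x| ^+ n * phi x <= C.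
  have [C CP] := exprn_le_expR_sqr n half0.
  exists (C * normal_peak 1) => x; rewrite normal_pdf01E mulrCA mulrC.
  rewrite ler_wpM2r ?normal_peak_ge0 // expRN ler_pdivrMr ?expR_gt0 //.
  by rewrite [x ^+ 2 / 2]mulrC.
exists (\sum_(i < size p) `|p`_i| * C i) => x; rewrite horner_coef mulr_suml.
rewrite (le_trans (ler_norm_sum _ _ _)) // ler_sum // => i _.
by rewrite -mulrA normrM ler_wpM2l // normrM normrX (gtr0_norm (normal_pdf01_gt0 x)).
Qed.

Lemma integrable_monomial_normal_pdf n :
  mu.-integrable setT (fun x => (x ^+ n * phi x)%:E).
Proof.
have quarter0 : 0 < 4^-1 :> R by rewrite invr_gt0.
have [C CP] := exprn_le_expR_sqr n quarter0.
(* Half of the exponent absorbs [|x|^n]; the remaining [exp(- x^2 / 4)] is, up to a constant, the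
   normal density of variance 2. *)
pose s : R := Num.sqrt 2; pose K := C * normal_peak 1 / normal_peak s.
have s0 : s != 0 by rewrite sqrtr_eq0 -ltNge.
have i_s : mu.-integrable setT (fun x => (K * normal_pdf 0 s x)%:E).
  have := integrableZl measurableT K (integrable_normal_pdf 0 s).
  by apply: eq_integrable.
apply: le_integrable i_s => //.
  apply/measurable_EFinP; apply: measurable_funM; last exact: measurable_normal_pdf.
  exact: measurable_funX.
move=> x _; rewrite /= lee_fin (le_trans _ (ler_norm _)) // normrM normrX.
rewrite (gtr0_norm (normal_pdf01_gt0 x)) normal_pdf01E normal_pdfE // /normal_fun subr0.
have -> : - x ^+ 2 / (s ^+ 2 *+ 2) = 4^-1 * x ^+ 2 - x ^+ 2 / 2.
  by rewrite sqr_sqrtr //; field.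
have peak0 : normal_peak s != 0 by rewrite gt_eqF ?normal_peak_gt0.
have KE (a b : R) : K * (normal_peak s * (a * b)) = C * a * (normal_peak 1 * b).
  by rewrite /K; field.
rewrite expRD KE ler_wpM2r // mulr_ge0 ?expR_ge0 //; exact: normal_peak_ge0.
Qed.

Lemma negligible_roots (q : {poly R}) : q != 0 -> mu.-negligible [set x | root q x].
Proof.
have [n] := ubnP (size q); elim: n q => // n IHn q; rewrite ltnS => le_qn q0.
have [[a qa]|no_root] := pselect (exists a, root q a); last first.
  rewrite (_ : [set x | _] = set0); first exact: negligible_set0.
  by apply/seteqP; split => // x qx; apply: no_root; exists x.
have /factor_theorem[q1 qE] := qa.
have q10 : q1 != 0 by apply: contra_neq q0 => q10; rewrite qE q10 mul0r.
have negU : mu.-negligible ([set x | root q1 x] `|` [set a]).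
  apply: negligibleU; last by exists [set a]; split=> //; exact: lebesgue_measure_set1.
  apply: (IHn q1) => //; rewrite (leq_trans _ le_qn) // qE size_Mmonic ?monicXsubC //.
  by rewrite size_XsubC addn2.
apply: negligibleS negU => x.
by rewrite /= qE rootM root_XsubC => /orP[|/eqP]; [left|right].
Qed.

Lemma not_negligible_line : ~ mu.-negligible setT.
Proof.
move=> negT; have : mu `[0%R, 1%R]%classic = 0%E.
  by apply/negligibleP; [exact: measurable_itv|exact: negligibleS negT].
rewrite lebesgue_measure_itv /= lte_fin ltr01 oppr0 adde0 => /eqP.
by rewrite eqe oner_eq0.
Qed.

End GaussianBounds.

(** * Right multiples of [d - x] have mean zero on every test class *)

Section SteinClass.
Variable R : realType.
Context d (T : measurableType d) (P : probability T R) (N : {RV P >-> R}).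
Hypothesis hN : forall B : set R, measurable B ->
  distribution P N B = normal_prob 0 1 B.
Local Notation phi := (@normal_pdf R 0 1).
Implicit Types (S L : weyl R) (f : R -> R).

Lemma integrable_weyl_act k m S f :
  (forall j t, (j <= m)%N -> (t <= k)%N ->
    P.-integrable setT (fun w => (N w ^+ j * derive1n t f (N w))%:E)) ->
  (size (weyl_coef S) <= k.+1)%N ->
  (forall t, (size ((weyl_coef S)`_t)%R <= m.+1)%N) ->
  P.-integrable setT (fun w => (weyl_act S f (N w))%:E).
Proof.
move=> fi le_Sk le_Sm.
have : P.-integrable setT (fun w => \sum_(t < k.+1) \sum_(j < m.+1)
    ((weyl_coef S)`_t`_j)%:E * (N w ^+ j * derive1n t f (N w))%:E)%E.
  apply: integrable_sum => // t _; apply: integrable_sum => // j _.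
  by apply: integrableZl => //; apply: fi; rewrite -ltnS.
apply: eq_integrable => // w _; rewrite (weyl_actE _ _ le_Sk) -sumEFin.
apply: eq_bigr => t _; rewrite (horner_coef_wide _ (le_Sm t)) mulr_suml -sumEFin.
by apply: eq_bigr => j _; rewrite -EFinM mulrA.
Qed.

Lemma size_coef_xdeg S t : (size ((weyl_coef S)`_t)%R <= (weyl_xdeg S).+1)%N.
Proof.
have [lt_tS|le_St] := ltnP t (size (weyl_coef S)); last first.
  by rewrite [(weyl_coef S)`_t]nth_default // size_poly0.
have : ((size ((weyl_coef S)`_t)%R).-1 <= weyl_xdeg S)%N.
  pose sz (t : 'I_(size (weyl_coef S))) := (size ((weyl_coef S)`_t)%R).-1.
  exact: (leq_bigmax (F := sz) (Ordinal lt_tS)).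
by case: (size _).
Qed.

(** This is the Stein identity for [g = L f]; the moments assumed for [(d - x) L] also control
    [L f]. *)
Lemma stein_op_mean_zero L f : integrable_class N (stein_op R * L) f ->
  P.-integrable setT (EFin \o (weyl_act (stein_op R * L) f \o N)) /\
  ('E_P[weyl_act (stein_op R * L)%R f \o N] = 0)%E.
Proof.
set S := stein_op R * L => -[]; set k := maxn 1 (weyl_order S); set m := weyl_xdeg S.
move=> fk fi; have le_Sm := @size_coef_xdeg S.
have le_Lm := size_coef_stein_op le_Sm.
have [le_Sk le_Lk] : (size (weyl_coef S) <= k.+1)%N /\ (size (weyl_coef L) <= k)%N.
  rewrite /k /weyl_order; have [L0|L0] := eqVneq L 0.
    by rewrite /S L0 mulr0 size_poly0.
  by rewrite /S size_weyl_coef_stein_op //= leq_maxr ltnS leq_maxr.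
have iS := integrable_weyl_act fi le_Sk le_Sm.
split; first exact: iS.
have iL := integrable_weyl_act fi (leqW le_Lk) le_Lm.
rewrite unlock.
under eq_integral => w _ do rewrite /= weyl_act_stein_op.
apply: (stein_identity hN) => //.
- by move=> x; exact: weyl_act_is_derive fk le_Lk.
- exact: (continuous_weyl_act fk (size_weyl_coef_dx le_Lk)).
- move: iS; apply: eq_integrable => // w _.
  by rewrite weyl_act_stein_op.
Qed.

Lemma derive1n_horner (p : {poly R}) t : derive1n t (horner p) = horner p^`(t).
Proof. by elim: t => // t IHt; rewrite derive1nS IHt derivnS derivE. Qed.

Lemma smooth_horner (p : {poly R}) : smooth (horner p).
Proof.
move=> k; split=> [t _ x|]; rewrite derive1n_horner.
  exact: derivable_horner.
exact: continuous_horner.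
Qed.

(** Differentiation keeps the form polynomial times [phi], which is bounded; hence these functions
    are Schwartz. *)
Lemma derive1n_horner_normal_pdf (p : {poly R}) t :
  derive1n t (fun x => p.[x] * phi x) =
  fun x => (iter t (fun q => - creation q) p).[x] * phi x.
Proof.
elim: t => // t IHt; rewrite derive1nS IHt /=; apply/funext => x.
move: (iter t _ p) => q; rewrite derive1E.
have := is_deriveM (is_derive_poly q x) (is_derive_normal_pdf x).
move=> /(@derive_val _ _ _ _ _ _ _).
rewrite -[X in 'D_1 X x = _]/(fun x => q.[x] * phi x) => ->.
rewrite /creation opprB hornerD hornerN hornerM hornerX /GRing.scale /=; ring.
Qed.

Lemma schwartz_horner_normal_pdf (p : {poly R}) : schwartz (fun x => p.[x] * phi x).
Proof.
split=> [k|a b].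
  split=> [t _ x|]; rewrite derive1n_horner_normal_pdf.
    apply: derivableM; first exact: derivable_horner.
    exact: (@ex_derive _ _ _ _ _ _ _ (is_derive_normal_pdf x)).
  move=> x; apply: cvgM; first exact: continuous_horner.
  exact: (@continuous_normal_pdf _ 0 1 (oner_neq0 R)).
have [C CP] := poly_gauss_bounded ('X^a * iter b (fun q => - creation q) p).
by exists C => x; rewrite derive1n_horner_normal_pdf mulrA -hornerXn -hornerM.
Qed.

Lemma integrable_horner_gauss (p : {poly R}) :
  P.-integrable setT (fun w => (p.[N w])%:E).
Proof.
have : P.-integrable setT (fun w => \sum_(j < size p) (p`_j)%:E * (N w ^+ j)%:E)%E.
  apply: integrable_sum => // j _; apply: integrableZl => //.
  apply/(integrable_gauss hN (f := fun x => x ^+ j)); first exact: measurable_funX.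
  exact: integrable_monomial_normal_pdf.
apply: eq_integrable => // w _; rewrite horner_coef -sumEFin.
by apply: eq_bigr => j _; rewrite EFinM.
Qed.

Lemma integrable_bounded_gauss f (p : {poly R}) : continuous f ->
  (forall x, `|f x| <= p.[x]) -> P.-integrable setT (fun w => (f (N w))%:E).
Proof.
move=> cf fp; apply: le_integrable (integrable_horner_gauss p) => //.
  apply/measurable_EFinP; apply: measurableT_comp => //.
  exact: continuous_measurable_fun.
by move=> w _; rewrite /= lee_fin (le_trans (fp _)) // ler_norm.
Qed.

Lemma smooth_integrable_class S f : smooth f ->
  (forall j t, exists p : {poly R}, forall x, `|x ^+ j * derive1n t f x| <= p.[x]) ->
  integrable_class N S f.
Proof.
move=> sf f_bound; split=> [//|j t _ _].
have [p pP] := f_bound j t; apply: (integrable_bounded_gauss (p := p)) pP => x.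
apply: cvgM; first exact: exprn_continuous.
exact: (Ck_continuous (sf t) (leqnn t)).
Qed.

Lemma abs_horner_le (p : {poly R}) : exists q : {poly R}, forall x, `|p.[x]| <= q.[x].
Proof.
exists (1 + p * p) => x; rewrite hornerD hornerM -[1]/(1%:P) hornerC.
have : `|p.[x]| ^+ 2 = p.[x] * p.[x] by rewrite real_normK ?num_real.
move=> <-; have := sqr_ge0 (`|p.[x]| - 1).
by have := normr_ge0 p.[x]; nra.
Qed.

(** Polynomial bounds suffice, since the Gaussian has all moments. The operator-dependent class thus
    contains the other three, and one proof of mean zero serves all. *)
Lemma test_functions_integrable F S f :
  test_functions N F S f -> integrable_class N S f.
Proof.
case: F => [[sf fb]|[p ->]|[sf fb]|//].
- apply: smooth_integrable_class => // j t; have [C CP] := fb j t.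
  by exists C%:P => x; rewrite hornerC.
- apply: smooth_integrable_class; first exact: smooth_horner.
  move=> j t; have [q qP] := abs_horner_le ('X^j * p^`(t)).
  by exists q => x; have := qP x; rewrite hornerM hornerXn derive1n_horner.
- apply: smooth_integrable_class => // j t; have [a _ [C CP]] := fb t.
  (* The weight [1 + |x|^a] is replaced by the larger polynomial [2 + x^(2 a)]. *)
  have [q qP] := abs_horner_le (C *: ('X^j * (2%:P + 'X^(2 * a)))).
  exists q => x; apply: le_trans (qP x).
  have w_gt0 : 0 < 1 + `|x| ^+ a by rewrite ltr_wpDr // exprn_ge0.
  have w_le : 1 + `|x| ^+ a <= 2 + x ^+ (2 * a).
    rewrite mulnC exprM -[(x ^+ a) ^+ 2]real_normK ?num_real // normrX.
    by have := sqr_ge0 (`|x| ^+ a - 1); have := exprn_ge0 a (normr_ge0 x); nra.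
  have C_ge0 : 0 <= C by exact: le_trans (normr_ge0 _) (CP 0).
  rewrite hornerZ hornerM hornerXn hornerD hornerC hornerXn mulrCA !normrM.
  rewrite ler_wpM2l // (ger0_norm C_ge0) (@ger0_norm _ (2 + _)); last first.
    by rewrite (le_trans _ w_le) ?ltW.
  apply: (@le_trans _ _ (C * (1 + `|x| ^+ a))); last by rewrite ler_wpM2l.
  have := CP x; rewrite normrM normfV (gtr0_norm w_gt0) mulrC ler_pdivrMr //.
Qed.

End SteinClass.

(** * Every Stein operator is a right multiple of [d - x] *)

Section SteinIdealGaussian.
Variable R : realType.
Context d (T : measurableType d) (P : probability T R) (N : {RV P >-> R}).
Hypothesis hN : forall B : set R, measurable B ->
  distribution P N B = normal_prob 0 1 B.
Local Notation mu := (@lebesgue_measure R).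
Local Notation phi := (@normal_pdf R 0 1).

Lemma schwartz_poly_growth (f : R -> R) : schwartz f -> poly_growth f.
Proof.
move=> [sf fb]; split=> // b; exists 1%N => //; have [C CP] := fb 0%N b.
exists C => x; have w_ge1 : 1 <= 1 + `|x| ^+ 1 by rewrite lerDl.
have w_gt0 := lt_le_trans ltr01 w_ge1; have := CP x; rewrite expr0 mul1r => fC.
rewrite normrM normfV (gtr0_norm w_gt0) mulrC ler_pdivrMr // (le_trans fC) //.
by rewrite ler_peMr // (le_trans _ fC).
Qed.

Lemma positive_weight_test_functions F : exists w : R -> R,
  [/\ continuous w, forall x, 0 < w x &
   forall (q : {poly R}) S, test_functions N F S (fun x => q.[x] * w x)].
Proof.
have cphi : continuous phi := @continuous_normal_pdf _ 0 1 (oner_neq0 R).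
have phi_gt0 := @normal_pdf01_gt0 R; have phiS := @schwartz_horner_normal_pdf R.
case: F.
- by exists phi; split=> // q S; exact: phiS.
- exists (fun=> 1); split=> [x|//|q S]; first exact: cvg_cst.
  by exists q; apply/funext => x; rewrite mulr1.
- by exists phi; split=> // q S; exact: schwartz_poly_growth.
- exists phi; split=> // q S.
  exact: (test_functions_integrable hN (F := Schwartz) (phiS q)).
Qed.

(** A nonnegative integrand of integral 0 vanishes almost everywhere, but for [q != 0] this one is
    positive off the null set of roots of [q]. *)
Lemma gauss_mean_sqr_eq0 (q : {poly R}) (w : R -> R) :
  continuous w -> (forall x, 0 < w x) ->
  (\int[P]_v (q.[N v] * (q.[N v] * w (N v)))%:E = 0)%E -> q = 0.
Proof.
move=> cw w_gt0; pose f x := q.[x] * (q.[x] * w x).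
have cf : continuous f.
  by move=> x; do 2 (apply: cvgM; first exact: continuous_horner); exact: cw.
have mf : measurable_fun setT f by exact: continuous_measurable_fun.
have f_ge0 x : 0 <= f x * phi x.
  rewrite mulr_ge0 ?normal_pdf_ge0 // /f mulrA -expr2 mulr_ge0 ?sqr_ge0 //.
  exact: ltW.
rewrite (integral_gauss hN mf) => f0; apply/eqP; apply: contraT => q0.
have mfp : measurable_fun setT (fun x => (f x * phi x)%:E).
  by apply/measurable_EFinP; apply: measurable_funM => //; exact: measurable_normal_pdf.
have : ae_eq mu setT (fun x => (f x * phi x)%:E) (cst 0%E).
  apply/(ae_eq_integral_abs mu measurableT mfp); rewrite -[RHS]f0.
  by apply: eq_integral => x _; rewrite gee0_abs ?lee_fin.
move=> neg; case: (@not_negligible_line R).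
apply: negligibleS (negligibleU neg (negligible_roots q0)) => x _ /=.
have [?|qx] := boolP (root q x); [by right|left => /(_ I) /eqP].
rewrite eqe /f !mulf_eq0 -!rootE (negbTE qx) /=.
by rewrite !gt_eqF // normal_pdf01_gt0.
Qed.

Lemma PSOE F : PSO N F = right_multiples (stein_op R).
Proof.
apply/seteqP; split=> [S S_PSO|_ [L _ <-] f fS]; last first.
  exact/(stein_op_mean_zero hN)/(test_functions_integrable hN fS).
rewrite right_multiples_stein_op /=.
have [w [cw w_gt0 w_test]] := positive_weight_test_functions F.
have [L SE] := gauss_adjoint_decomp S; set q := gauss_adjoint S in SE *.
apply: (gauss_mean_sqr_eq0 cw w_gt0).
(* With [q] the adjoint of [S], the test function [q w] gives [S f - (d - x) L f = q f = q^2 w], and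
   both terms on the left have mean zero. *)
pose f x := q.[x] * w x; have [iS] := S_PSO _ (w_test q S).
have iC := test_functions_integrable hN (w_test q (stein_op R * L)).
have [iL] := stein_op_mean_zero hN iC.
rewrite !unlock => L0 S0.
have qE v : (q.[N v] * (q.[N v] * w (N v)))%:E =
    ((weyl_act S f (N v))%:E - (weyl_act (stein_op R * L) f (N v))%:E)%E.
  rewrite -EFinB -weyl_actB -(weyl_act_mulop q f (N v)); congr (weyl_act _ _ _)%:E.
  by rewrite {1}SE addrC addKr.
by rewrite (eq_integral _ _ (fun v _ => qE v)) integralB // S0 L0 sube0.
Qed.

End SteinIdealGaussian.

Theorem theorem3p1 (R : realType) (d : measure_display) (T : measurableType d)
    (P : probability T R) (N : {RV P >-> R})
    (hN : forall B : set R, measurable B ->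
      distribution P N B = normal_prob 0 1 B)
    (F : test_class) :
  (submodule (PSO N F) /\ is_basis (hermite_basis R) (PSO N F)) /\
  [/\ principal_right_ideal (PSO N F),
      maximal_right_ideal (PSO N F)
    & PSO N F = right_multiples (dx R - mulop 'X)] /\
  exists hI : right_ideal (PSO N F),
    [/\ cyclic_module (ideal_mod hI),
        ~ holonomic (ideal_mod hI),
        holonomic (ideal_quot hI),
        bernstein_dim (ideal_quot hI) = 1%N
      & bernstein_dim (ideal_mod hI) = 2%N].
Proof.
rewrite (PSOE hN F); have hI := right_ideal_right_multiples (stein_op R).
split; last split.
- rewrite right_multiples_stein_op; split; last exact: hermite_basis_is_basis.
  split=> /= [|c S S' S0 S'0]; first exact: gauss_adjoint0.
  by rewrite gauss_adjointD gauss_adjointZ S0 S'0 scaler0 addr0.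
- split=> //; last exact: maximal_right_ideal_stein_op.
  by split=> //; exists (stein_op R).
have dim1 := bernstein_dim_ideal_quot hI; have dim2 := bernstein_dim_ideal_mod hI.
exists hI; split=> //; first exact: cyclic_ideal_mod.
  by case=> _; rewrite dim2.
by split=> //; exact: fin_gen_ideal_quot.
Qed.
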